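(* Let $\mathbb{T}^2=[0,1]^2$ be the two-dimensional torus and let $u\in C^\infty(\mathbb{T}^2)$ be the cellular flow $$u(x)=\nabla^{\perp}\big(\sin(2\pi x_1)\sin(2\pi x_2)\big),\qquad \nabla^\perp=(-\partial_{x_2},\partial_{x_1}).$$ Fix $\gamma>0$ and $\alpha\geq 1$. Then for any $\epsilon>0$ there exists $m_0>0$ such that for any $m\geq m_0$ there exists $A_0>0$ such that $$\tau_{\alpha}^{*}\big(A\,u(m\,\cdot),\gamma\big)\leq \epsilon\qquad\text{for all } A\geq A_0 .$$
   Context: Let $L^2_0$ denote the subspace of mean-zero functions in $L^2(\mathbb{T}^d)$. For a divergence-free velocity field $v$ on $\mathbb{T}^d$ and $\alpha,\gamma>0$, consider the advection (hyper/fractional) diffusion equation $$\partial_t\theta+v\cdot\nabla\theta+\gamma(-\Delta)^{\alpha}\theta=0\quad\text{on }(0,\infty)\times\mathbb{T}^d .$$ Let $\mathcal{S}^{v,\alpha}_{s,t}$ denote its solution operator: for $\theta_s\in L^2_0$, $\mathcal{S}^{v,\alpha}_{s,t}\theta_s$ is the solution at time $t$ with data $\theta(s,\cdot)=\theta_s$. The dissipation time of $v$ is $$\tau^*_\alpha(v,\gamma)=\inf\Big\{t\geq 0:\ \big\|\mathcal{S}^{v,\alpha}_{s,s+t}\big\|_{L^2_0\to L^2_0}\leq \tfrac12\ \text{for all } s\geq 0\Big\}.$$ Here $u(m\,\cdot)$ denotes the field $x\mapsto u(mx)$. *)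

(* Defs.v *)
From Stdlib Require Import Reals Lra ZArith List.
From Coquelicot Require Import Coquelicot.
Import ListNotations.
Open Scope R_scope.

(* Functions on T^2 = [0,1]^2 are represented through their Fourier           *)
(* coefficients  f : Z*Z -> C  (f(x) = sum_k f_k e^{2 pi i k.x}).  By          *)
(* Parseval, the L^2(T^2) norm is the l^2(Z^2) norm of the coefficients.       *)

Definition mode := (Z * Z)%type.

Definition zrange (N : nat) : list Z :=
  map (fun i => (Z.of_nat i - Z.of_nat N)%Z) (seq 0 (2 * N + 1)).

Definition box (N : nat) : list mode := list_prod (zrange N) (zrange N).

Definition boxsum (N : nat) (g : mode -> R) : R :=
  fold_right Rplus 0 (map g (box N)).

(* sum over Z^2 of a nonnegative family (supremum of the box partial sums) *)
Definition tsum (g : mode -> R) : Rbar :=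
  Lub_Rbar (fun r => exists N, r = boxsum N g).

Definition norm2 (f : mode -> C) : Rbar := tsum (fun k => Cmod (f k) ^ 2).

Definition hnorm2 (n : nat) (f : mode -> C) : Rbar :=
  tsum (fun k => (1 + IZR (fst k) ^ 2 + IZR (snd k) ^ 2) ^ n * Cmod (f k) ^ 2).

Definition Csub (f g : mode -> C) : mode -> C := fun k => Cminus (f k) (g k).

(* the (real-valued, mean zero) L^2 functions: L^2_0(T^2) *)
Definition L2_0 (f : mode -> C) : Prop :=
  is_finite (norm2 f) /\
  f (0, 0)%Z = RtoC 0 /\
  (forall k : mode, f (- fst k, - snd k)%Z = Cconj (f k)).

(* Fourier symbol of (-Delta)^alpha on T^2:  |2 pi k|^{2 alpha} *)
Definition frac_symbol (alpha : R) (k : mode) : R :=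
  if (Z.eqb (fst k) 0 && Z.eqb (snd k) 0)%bool then 0
  else Rpower (4 * PI ^ 2 * (IZR (fst k) ^ 2 + IZR (snd k) ^ 2)) alpha.

(* A velocity field given by finitely many Fourier modes:
   v(x) = sum_{(j,(a,b)) in v} (a,b) e^{2 pi i j.x}  (modes listed once). *)
Definition vfield := list (mode * (C * C)).

(* Fourier coefficients of v . grad f at mode k:
   sum_j vhat_j . (2 pi i (k-j)) fhat_{k-j} *)
Definition advect (v : vfield) (f : mode -> C) (k : mode) : C :=
  fold_right Cplus (RtoC 0)
    (map (fun jab : mode * (C * C) =>
            let j := fst jab in
            let a := fst (snd jab) in
            let b := snd (snd jab) in
            let d1 := IZR (fst k - fst j) in
            let d2 := IZR (snd k - snd j) in
            Cmult (Cplus (Cmult a (0, 2 * PI * d1)) (Cmult b (0, 2 * PI * d2)))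
                  (f (fst k - fst j, snd k - snd j)%Z))
         v).

(* Fourier coefficients of x |-> A * u(m x), where
   u = grad^perp (sin(2 pi x1) sin(2 pi x2)), i.e.
   u1(x) = -2 pi sin(2 pi x1) cos(2 pi x2),  u2(x) = 2 pi cos(2 pi x1) sin(2 pi x2).
   A u(m x) = sum_{s in {+-1}^2} (i pi A s1/2, -i pi A s2/2) e^{2 pi i m s.x}. *)
Definition cellular_hat (A : R) (m : nat) : vfield :=
  map (fun s : Z * Z =>
         ((Z.of_nat m * fst s, Z.of_nat m * snd s)%Z,
          ((0, PI * A * IZR (fst s) / 2), (0, - (PI * A * IZR (snd s) / 2)))))
      [(1, 1); (1, -1); (-1, 1); (-1, -1)]%Z.

(* theta is a solution on [s, oo) of
     d_t theta + v . grad theta + gamma (-Delta)^alpha theta = 0,  theta(s) = th0,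
   in the class of solutions that are continuous into L^2 at time s and
   smooth (locally uniformly bounded in every H^n) for t > s, the equation
   holding mode by mode for t > s.  For smooth v and L^2 data the solution
   exists and is unique in this class. *)
Definition is_solution (v : vfield) (alpha gamma : R) (s : R)
    (th0 : mode -> C) (theta : R -> mode -> C) : Prop :=
  theta s = th0 /\
  (forall eps, 0 < eps -> exists delta, 0 < delta /\
      forall t, s < t < s + delta -> Rbar_le (norm2 (Csub (theta t) th0)) eps) /\
  (forall a b, s < a -> a <= b -> forall n : nat, exists Cst : R,
      forall t, a <= t <= b -> Rbar_le (hnorm2 n (theta t)) Cst) /\
  (forall t, s < t -> forall k : mode,
      let rhs := Copp (Cplus (Cmult (RtoC (gamma * frac_symbol alpha k)) (theta t k))
                             (advect v (theta t) k)) in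
      derivable_pt_lim (fun tau => fst (theta tau k)) t (fst rhs) /\
      derivable_pt_lim (fun tau => snd (theta tau k)) t (snd rhs)).

(* || S^{v,alpha}_{s,s+t} ||_{L^2_0 -> L^2_0} <= 1/2  for all s >= 0 *)
Definition half_contracting (v : vfield) (alpha gamma t : R) : Prop :=
  forall s, 0 <= s -> forall th0 theta, L2_0 th0 -> is_solution v alpha gamma s th0 theta ->
    Rbar_le (norm2 (theta (s + t))) (Rbar_mult (/ 4) (norm2 th0)).

(* dissipation time tau*_alpha(v, gamma)  (inf of the empty set = +oo) *)
Definition tau_star (v : vfield) (alpha gamma : R) : Rbar :=
  Glb_Rbar (fun t => 0 <= t /\ half_contracting v alpha gamma t).

(* Main.v *)
Require Import Defs.
From Stdlib Require Import Reals Lra Lia ZArith List Permutation Bool.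
From Coquelicot Require Import Coquelicot.
Import ListNotations.
Open Scope R_scope.

(** In Fourier variables the cellular flow couples [k] to [k + m s], [s] in
    [{+-1}^2], with the real coefficients [+- (s1 k1 - s2 k2)].  Modes with
    [|k|] of order [m] are damped at rate [gamma m^2], so only the finitely many
    low modes have to be treated.  At such a mode, say with [|k1| >= |k2|], pair
    [theta_k] with a trace of [theta] on a separatrix line of the cells: along it
    [sin(2 pi y) F' = G], whose nonzero solutions just fail to lie in [H^(1/2)].
    Quantitatively, a logarithmic cutoff [phi] on the class of [k] modulo [m]
    makes [Y_k = theta_k <phi, theta> / (pi^2 A k1)] satisfy
      [Y_k' >= theta_k^2 - rho sum |k + m p|^2 theta_(k + m p)^2 - O(1/A)],
    where [rho] is as small as desired for a long cutoff and then a large [m].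
    Hence [|theta|^2 - beta sum_k Y_k] is a Lyapunov function decaying at a rate
    [beta / 2] chosen in advance. *)

(** * Finite sums over lists *)

(** Advection is skew, so [A] is invisible in the energy balance; it is felt only through a
    quadratic form of size [1/A] whose derivative is of order one. That derivative contains the
    advection transposed onto [phi], which has to be large at [k] and, at every other site, cheap
    enough for the dissipation to pay. A site at distance [r] costs about [1/(r log M)] times its
    frequency, and in the plane the squares [(r log M)^(-2)] add up to order [1/log M]: the
    borderline case, in which a point has zero capacity, is what makes [kappa] as small as desired.

    The parameters are spent in a fixed order. The rate [beta] and [gamma] fix the length [M] of the
    cutoff; then [m] is taken large against the number of sites used, which depends on [M] only;
    then [A] is taken large against the damping on those finitely many sites, however strong the
    power [alpha] makes it there. Hence [A0] depends on [m].

    All sums run over finite boxes. Truncation breaks the skewness, but for fixed [A] the flux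
    through the boundary of the box vanishes as the box grows, thanks to the smoothness of the
    solution. *)

Definition lsum {T : Type} (l : list T) (g : T -> R) : R :=
  fold_right Rplus 0 (map g l).

Lemma lsum_cons {T : Type} (a : T) l g : lsum (a :: l) g = g a + lsum l g.
Proof. reflexivity. Qed.

Lemma lsum_ext {T : Type} (l : list T) f g :
  (forall a, In a l -> f a = g a) -> lsum l f = lsum l g.
Proof.
  induction l as [|a l IH]; intros H; [reflexivity|].
  rewrite !lsum_cons, (H a (or_introl eq_refl)), IH; auto.
  intros; apply H; right; assumption.
Qed.

Lemma lsum_le {T : Type} (l : list T) f g :
  (forall a, In a l -> f a <= g a) -> lsum l f <= lsum l g.
Proof.
  induction l as [|a l IH]; intros H; [apply Rle_refl|].
  rewrite !lsum_cons. apply Rplus_le_compat.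
  - apply H; left; reflexivity.
  - apply IH; intros; apply H; right; assumption.
Qed.

Lemma lsum_0 {T : Type} (l : list T) : lsum l (fun _ => 0) = 0.
Proof. induction l as [|a l IH]; [reflexivity|]. rewrite lsum_cons, IH. lra. Qed.

Lemma lsum_nonneg {T : Type} (l : list T) g :
  (forall a, In a l -> 0 <= g a) -> 0 <= lsum l g.
Proof. intros H. rewrite <- (lsum_0 l). now apply lsum_le. Qed.

Lemma lsum_plus {T : Type} (l : list T) f g :
  lsum l (fun a => f a + g a) = lsum l f + lsum l g.
Proof. induction l as [|a l IH]; [cbn; lra|]. rewrite !lsum_cons, IH. lra. Qed.

Lemma lsum_scal {T : Type} (l : list T) c g :
  lsum l (fun a => c * g a) = c * lsum l g.
Proof. induction l as [|a l IH]; [cbn; lra|]. rewrite !lsum_cons, IH. lra. Qed.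

Lemma lsum_const {T : Type} (l : list T) c :
  lsum l (fun _ => c) = INR (length l) * c.
Proof.
  induction l as [|a l IH]; [cbn; lra|].
  rewrite lsum_cons, IH. cbn [length]. rewrite S_INR. lra.
Qed.

Lemma lsum_Rabs {T : Type} (l : list T) g :
  Rabs (lsum l g) <= lsum l (fun a => Rabs (g a)).
Proof.
  induction l as [|a l IH]; [cbn; rewrite Rabs_R0; lra|].
  rewrite !lsum_cons. eapply Rle_trans; [apply Rabs_triang|lra].
Qed.

Lemma lsum_term {T : Type} (l : list T) g a :
  (forall b, In b l -> 0 <= g b) -> In a l -> g a <= lsum l g.
Proof.
  induction l as [|b l IH]; intros H [].
  - subst. rewrite lsum_cons.
    assert (0 <= lsum l g) by (apply lsum_nonneg; intros; apply H; right; assumption).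
    lra.
  - rewrite lsum_cons. assert (0 <= g b) by (apply H; left; reflexivity).
    assert (g a <= lsum l g) by (apply IH; auto; intros; apply H; right; assumption).
    lra.
Qed.

Lemma lsum_perm {T : Type} (l1 l2 : list T) g :
  Permutation l1 l2 -> lsum l1 g = lsum l2 g.
Proof.
  induction 1; rewrite ?lsum_cons; lra.
Qed.

Lemma lsum_map {T U : Type} (f : T -> U) l g :
  lsum (map f l) g = lsum l (fun a => g (f a)).
Proof. unfold lsum. now rewrite map_map. Qed.

Lemma lsum_app {T : Type} (l1 l2 : list T) g :
  lsum (l1 ++ l2) g = lsum l1 g + lsum l2 g.
Proof.
  induction l1 as [|a l IH]; [unfold lsum; cbn; ring|].
  cbn [app]. rewrite !lsum_cons, IH. lra.
Qed.

Lemma lsum_prod {T U : Type} (l1 : list T) (l2 : list U) g :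
  lsum (list_prod l1 l2) g = lsum l1 (fun a => lsum l2 (fun b => g (a, b))).
Proof.
  induction l1 as [|a l IH]; [reflexivity|].
  cbn [list_prod]. rewrite lsum_app, lsum_cons, IH, lsum_map. reflexivity.
Qed.

Lemma lsum_swap {T U : Type} (l1 : list T) (l2 : list U) (g : T -> U -> R) :
  lsum l1 (fun a => lsum l2 (g a)) = lsum l2 (fun b => lsum l1 (fun a => g a b)).
Proof.
  induction l1 as [|a l IH].
  - symmetry; apply lsum_0.
  - rewrite lsum_cons, IH, <- lsum_plus. apply lsum_ext. intros; now rewrite lsum_cons.
Qed.

Lemma lsum_filter {T : Type} (q : T -> bool) l g :
  lsum (filter q l) g = lsum l (fun a => if q a then g a else 0).
Proof.
  induction l as [|a l IH]; [reflexivity|].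
  cbn [filter]. rewrite lsum_cons. destruct (q a); rewrite ?lsum_cons, IH; lra.
Qed.

Lemma lsum_filter_split {T : Type} (q : T -> bool) l g :
  lsum l g = lsum (filter q l) g + lsum (filter (fun a => negb (q a)) l) g.
Proof.
  rewrite !lsum_filter, <- lsum_plus. apply lsum_ext; intros a _.
  destruct (q a); cbn; lra.
Qed.

(** Once the zero terms are discarded, both lists are duplicate-free with the same elements. This is
    what allows a box sum to be translated. *)
Lemma lsum_support {T : Type} (l1 l2 : list T) g :
  NoDup l1 -> NoDup l2 ->
  (forall a, g a <> 0 -> (In a l1 <-> In a l2)) -> lsum l1 g = lsum l2 g.
Proof.
  intros N1 N2 H.
  set (q := fun a => if Req_EM_T (g a) 0 then false else true).
  assert (F : forall l, lsum l g = lsum (filter q l) g).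
  { intros l. rewrite lsum_filter. apply lsum_ext. intros a _. unfold q.
    destruct (Req_EM_T (g a) 0); auto. }
  rewrite (F l1), (F l2). apply lsum_perm, NoDup_Permutation.
  - now apply NoDup_filter.
  - now apply NoDup_filter.
  - intros a. rewrite !filter_In. unfold q.
    destruct (Req_EM_T (g a) 0) as [E|E].
    + split; intros [_ ?]; discriminate.
    + specialize (H a E). tauto.
Qed.

Lemma lsum_incl {T : Type} (l1 l2 : list T) g :
  NoDup l1 -> NoDup l2 -> incl l1 l2 ->
  (forall a, In a l2 -> 0 <= g a) -> lsum l1 g <= lsum l2 g.
Proof.
  revert l2. induction l1 as [|a l1 IH]; intros l2 N1 N2 I H.
  - now apply lsum_nonneg.
  - inversion N1; subst.
    destruct (in_split a l2) as (u & v & ->); [apply I; left; reflexivity|].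
    rewrite <- (lsum_perm _ _ g (Permutation_middle u v a)), !lsum_cons.
    apply Rplus_le_compat_l, IH; auto.
    + now apply NoDup_remove_1 in N2.
    + intros b Hb. assert (Hb' : In b (u ++ a :: v)) by (apply I; right; assumption).
      apply in_app_or in Hb'. apply in_or_app. cbn in Hb'.
      destruct Hb' as [|[->|]]; auto. contradiction.
    + intros b Hb. apply H. apply in_app_or in Hb. apply in_or_app. cbn. tauto.
Qed.

(** Cauchy-Schwarz against the constant 1, obtained from the nonnegativity of the variance around
    the mean. *)
Lemma lsum_sqr_le {T : Type} (l : list T) g :
  lsum l g ^ 2 <= INR (length l) * lsum l (fun a => g a ^ 2).
Proof.
  assert (V : forall c, lsum l (fun a => (g a - c) ^ 2) =
    lsum l (fun a => g a ^ 2) - 2 * c * lsum l g + INR (length l) * c ^ 2).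
  { intros c. induction l as [|a l IH]; [cbn; lra|].
    rewrite !lsum_cons, IH. cbn [length]. rewrite S_INR. ring. }
  destruct l as [|a l']; [cbn; lra|].
  set (l := a :: l') in *.
  assert (Hn : 0 < INR (length l)) by (apply lt_0_INR; cbn; lia).
  specialize (V (lsum l g / INR (length l))).
  assert (P : 0 <= lsum l (fun a0 => (g a0 - lsum l g / INR (length l)) ^ 2))
    by (apply lsum_nonneg; intros; apply pow2_ge_0).
  rewrite V in P.
  apply (Rmult_le_compat_l (INR (length l))) in P; [|lra].
  rewrite Rmult_0_r in P.
  replace (INR (length l) * (lsum l (fun a0 => g a0 ^ 2) -
    2 * (lsum l g / INR (length l)) * lsum l g +
    INR (length l) * (lsum l g / INR (length l)) ^ 2))
    with (INR (length l) * lsum l (fun a0 => g a0 ^ 2) - lsum l g ^ 2) in P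
    by (field; lra).
  lra.
Qed.

Lemma is_derive_lsum {T : Type} (l : list T) (f : T -> R -> R) (df : T -> R) t :
  (forall a, In a l -> is_derive (f a) t (df a)) ->
  is_derive (fun u => lsum l (fun a => f a u)) t (lsum l df).
Proof.
  induction l as [|a l IH]; intros H.
  - apply (is_derive_const 0 t).
  - apply (is_derive_plus (f a) (fun u => lsum l (fun a => f a u))).
    + apply H; left; reflexivity.
    + apply IH; intros; apply H; right; assumption.
Qed.

(** * Boxes of Fourier modes *)

Lemma in_zrange N z : In z (zrange N) <-> (Z.abs z <= Z.of_nat N)%Z.
Proof.
  unfold zrange. rewrite in_map_iff. split.
  - intros (i & <- & Hi). apply in_seq in Hi. lia.
  - intros H. exists (Z.to_nat (z + Z.of_nat N)). split; [lia|]. apply in_seq. lia.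
Qed.

Lemma NoDup_zrange N : NoDup (zrange N).
Proof.
  apply FinFun.Injective_map_NoDup; [intros i j; lia|apply seq_NoDup].
Qed.

Lemma in_box N (k : mode) :
  In k (box N) <-> (Z.abs (fst k) <= Z.of_nat N /\ Z.abs (snd k) <= Z.of_nat N)%Z.
Proof.
  destruct k as [k1 k2]. unfold box, mode. rewrite in_prod_iff, !in_zrange. reflexivity.
Qed.

Lemma NoDup_list_prod {T U : Type} (l1 : list T) (l2 : list U) :
  NoDup l1 -> NoDup l2 -> NoDup (list_prod l1 l2).
Proof.
  intros N1 N2. induction N1 as [|a l1 Ha N1 IH]; [constructor|].
  cbn. apply NoDup_app.
  - apply FinFun.Injective_map_NoDup; auto. intros b c E; now inversion E.
  - exact IH.
  - intros [c d]. rewrite in_map_iff. intros (b & E & _). inversion E; subst.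
    rewrite in_prod_iff. tauto.
Qed.

Lemma NoDup_box N : NoDup (box N).
Proof. apply NoDup_list_prod; apply NoDup_zrange. Qed.

Lemma length_box N : length (box N) = ((2 * N + 1) * (2 * N + 1))%nat.
Proof.
  unfold box, zrange, mode. now rewrite length_prod, !length_map, !length_seq.
Qed.

Lemma boxsum_le N N' g : (N <= N')%nat -> (forall k, 0 <= g k) ->
  boxsum N g <= boxsum N' g.
Proof.
  intros HN Hg. apply lsum_incl; auto using NoDup_box.
  intros k. rewrite !in_box. lia.
Qed.

Definition zero_mode (k : mode) : bool := (Z.eqb (fst k) 0 && Z.eqb (snd k) 0)%bool.

Lemma zero_modeP k : zero_mode k = true <-> k = (0, 0)%Z.
Proof.
  destruct k as [a b]. unfold zero_mode; cbn.
  rewrite andb_true_iff, !Z.eqb_eq. split; [intros [-> ->]; reflexivity|].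
  intros E; inversion E; auto.
Qed.

Definition pbox (N : nat) : list mode :=
  filter (fun k => negb (zero_mode k)) (box N).

Lemma in_pbox N k : In k (pbox N) <-> In k (box N) /\ k <> (0, 0)%Z.
Proof.
  unfold pbox. rewrite filter_In, negb_true_iff, <- not_true_iff_false, zero_modeP.
  tauto.
Qed.

Lemma NoDup_pbox N : NoDup (pbox N).
Proof. apply NoDup_filter, NoDup_box. Qed.

Lemma lsum_box_pbox N g : lsum (box N) g = g (0, 0)%Z + lsum (pbox N) g.
Proof.
  rewrite (lsum_filter_split zero_mode). fold (pbox N). f_equal.
  replace (g (0, 0)%Z) with (lsum [(0, 0)%Z : mode] g) by (cbn; lra).
  apply lsum_perm, NoDup_Permutation.
  - apply NoDup_filter, NoDup_box.
  - constructor; [intros []|constructor].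
  - intros k. rewrite filter_In, zero_modeP, in_box. cbn. split.
    + intros [_ ->]; auto.
    + intros [<-|[]]. cbn. split; auto. lia.
Qed.

Lemma lsum_pbox_le N g : 0 <= g (0, 0)%Z -> lsum (pbox N) g <= lsum (box N) g.
Proof. intros. rewrite lsum_box_pbox. lra. Qed.

Definition znorm (k : mode) : Z := Z.max (Z.abs (fst k)) (Z.abs (snd k)).

(** The sphere of radius [r] for the sup norm contains [(2r+1)^2 - (2r-1)^2 = 8r] modes. *)
Lemma lsum_pbox_shells N (g : Z -> R) :
  lsum (pbox N) (fun k => g (znorm k)) =
  lsum (seq 1 N) (fun r => 8 * INR r * g (Z.of_nat r)).
Proof.
  induction N as [|N IH]; [reflexivity|].
  set (q := fun k => (znorm k <=? Z.of_nat N)%Z).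
  rewrite (lsum_filter_split q), seq_S, lsum_app, <- IH. f_equal.
  - apply lsum_perm, NoDup_Permutation; auto using NoDup_filter, NoDup_pbox.
    intros k. rewrite filter_In, !in_pbox, !in_box. unfold q, znorm.
    rewrite Z.leb_le. intuition lia.
  - rewrite (lsum_ext _ _ (fun _ => g (Z.of_nat (S N)))).
    2:{ intros k. rewrite filter_In, in_pbox, in_box. unfold q, znorm.
        rewrite negb_true_iff, Z.leb_gt. intros. f_equal. lia. }
    rewrite lsum_const.
    assert (L : length (filter (fun k => negb (q k)) (pbox (S N))) = (8 * S N)%nat).
    { pose proof (filter_length q (box (S N))) as F.
      rewrite length_box in F.
      assert (P : Permutation (filter q (box (S N))) (box N)).
      { apply NoDup_Permutation; auto using NoDup_filter, NoDup_box.
        intros k. rewrite filter_In, !in_box. unfold q, znorm.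
        rewrite Z.leb_le. lia. }
      apply Permutation_length in P. rewrite P, length_box in F.
      assert (P2 : Permutation (filter (fun k => negb (q k)) (pbox (S N)))
                               (filter (fun k => negb (q k)) (box (S N)))).
      { apply NoDup_Permutation; auto using NoDup_filter, NoDup_box, NoDup_pbox.
        intros k. rewrite !filter_In, in_pbox, !in_box. unfold q, znorm.
        rewrite negb_true_iff, Z.leb_gt. split; [tauto|].
        intros [? ?]; repeat split; try tauto. intros ->; cbn in *; lia. }
      apply Permutation_length in P2. rewrite P2. lia. }
    rewrite L, mult_INR, lsum_cons. change (1 + N)%nat with (S N).
    change (lsum (@nil nat) _) with 0. replace (INR 8) with 8 by (cbn; ring). ring.
Qed.

(** * Harmonic cutoff *)

Definition harm (n : nat) : R := lsum (seq 1 n) (fun i => / INR i).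

Lemma harm_S n : harm (S n) = harm n + / INR (S n).
Proof.
  unfold harm. rewrite seq_S, lsum_app. f_equal. rewrite lsum_cons.
  change (lsum (@nil nat) _) with 0. rewrite Rplus_0_r. reflexivity.
Qed.

Lemma harm_le n n' : (n <= n')%nat -> harm n <= harm n'.
Proof.
  induction 1 as [|n' _ IH]; [lra|]. rewrite harm_S.
  assert (0 < / INR (S n')) by (apply Rinv_0_lt_compat, lt_0_INR; lia). lra.
Qed.

Lemma ln_le_harm n : ln (INR (S n)) <= harm n.
Proof.
  induction n as [|n IH]; [cbn; rewrite ln_1; lra|].
  assert (Hp : 0 < INR (S n)) by (apply lt_0_INR; lia).
  assert (Hi : 0 < / INR (S n)) by now apply Rinv_0_lt_compat.
  rewrite harm_S.
  replace (INR (S (S n))) with (INR (S n) * (1 + / INR (S n)))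
    by (rewrite (S_INR (S n)); field; lra).
  rewrite ln_mult by lra.
  assert (ln (1 + / INR (S n)) <= / INR (S n)).
  { rewrite <- (ln_exp (/ INR (S n))) at 2. apply ln_le; [lra|].
    apply exp_ineq1_le. }
  lra.
Qed.

Lemma harm_unbounded B : exists n, B <= harm n.
Proof.
  destruct (INR_unbounded (exp B)) as [n Hn]. exists n.
  eapply Rle_trans; [|apply ln_le_harm].
  rewrite <- (ln_exp B) at 1. apply ln_le; [apply exp_pos|].
  rewrite S_INR. lra.
Qed.

(** Two increments [1/(r-1) + 1/r], at most [3/r] for [r >= 2]. For [r = 1] truncated subtraction
    leaves the single increment 1. *)
Lemma harm_step r : (1 <= r)%nat -> harm r - harm (r - 2) <= 3 / INR r.
Proof.
  intros Hr. destruct r as [|[|r]]; [lia| |].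
  - cbn [Nat.sub]. rewrite harm_S. change (harm 0) with 0. cbn. lra.
  - replace (S (S r) - 2)%nat with r by lia. rewrite !harm_S.
    set (a := INR (S r)).
    assert (1 <= a) by (apply (le_INR 1); lia).
    replace (INR (S (S r))) with (a + 1) by (unfold a; rewrite (S_INR (S r)); reflexivity).
    apply (Rmult_le_reg_r (a * (a + 1))); [nra|].
    replace ((harm r + / a + / (a + 1) - harm r) * (a * (a + 1)))
      with (2 * a + 1) by (field; lra).
    replace (3 / (a + 1) * (a * (a + 1))) with (3 * a) by (field; lra). lra.
Qed.

(** The profile [1 - log r / log M], with [harm] for the logarithm so that its increments are
    exactly [1/r]. The shift [r - 1] gives the value 1 on the first shell, where all neighbours of
    the origin lie, and the value 0 from [M + 1] on. *)
Definition cutoff (M : nat) (r : Z) : R :=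
  Rmax 0 (1 - harm (Z.to_nat (r - 1)) / harm M).

Lemma cutoff_bounds M r : 0 < harm M -> 0 <= cutoff M r <= 1.
Proof.
  intros H. unfold cutoff. split; [apply Rmax_l|]. apply Rmax_lub; [lra|].
  assert (0 <= harm (Z.to_nat (r - 1)) / harm M).
  { apply Rdiv_le_0_compat; auto. apply (harm_le 0). lia. }
  lra.
Qed.

Lemma cutoff_1 M : cutoff M 1 = 1.
Proof.
  unfold cutoff. replace (Z.to_nat (1 - 1)) with 0%nat by reflexivity.
  change (harm 0) with 0. unfold Rdiv. rewrite Rmult_0_l, Rmax_right; lra.
Qed.

Lemma cutoff_support M r : 0 < harm M -> cutoff M r <> 0 -> (r <= Z.of_nat M)%Z.
Proof.
  intros H N. destruct (Z.le_gt_cases r (Z.of_nat M)) as [|L]; auto.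
  exfalso; apply N. unfold cutoff. apply Rmax_left.
  assert (harm M <= harm (Z.to_nat (r - 1))) by (apply harm_le; lia).
  assert (1 <= harm (Z.to_nat (r - 1)) / harm M).
  { apply (Rmult_le_reg_r (harm M)); auto. unfold Rdiv.
    rewrite Rmult_assoc, Rinv_l; lra. }
  lra.
Qed.

Lemma Rmax_0_lipschitz u v : Rabs (Rmax 0 u - Rmax 0 v) <= Rabs (u - v).
Proof.
  unfold Rmax. destruct (Rle_dec 0 u), (Rle_dec 0 v);
    unfold Rabs; repeat destruct Rcase_abs; lra.
Qed.

Lemma cutoff_diff M r r1 r2 : 0 < harm M -> (1 <= r)%Z ->
  (r - 1 <= r1 <= r + 1)%Z -> (r - 1 <= r2 <= r + 1)%Z ->
  Rabs (cutoff M r1 - cutoff M r2) <= 3 / (IZR r * harm M).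
Proof.
  intros H Hr H1 H2. unfold cutoff. eapply Rle_trans; [apply Rmax_0_lipschitz|].
  set (n := Z.to_nat r).
  assert (B : forall r', (r - 1 <= r' <= r + 1)%Z ->
    harm (n - 2) <= harm (Z.to_nat (r' - 1)) <= harm n).
  { intros r' Hr'. split; apply harm_le; unfold n; lia. }
  assert (S : harm n - harm (n - 2) <= 3 / IZR r).
  { replace (IZR r) with (INR n) by (unfold n; rewrite INR_IZR_INZ; f_equal; lia).
    apply harm_step. unfold n; lia. }
  pose proof (B r1 H1) as B1. pose proof (B r2 H2) as B2.
  replace (1 - harm (Z.to_nat (r1 - 1)) / harm M - (1 - harm (Z.to_nat (r2 - 1)) / harm M))
    with ((harm (Z.to_nat (r2 - 1)) - harm (Z.to_nat (r1 - 1))) / harm M) by (field; lra).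
  assert (0 < IZR r) by (apply IZR_lt; lia).
  replace (3 / (IZR r * harm M)) with (3 / IZR r / harm M) by (field; lra).
  unfold Rdiv at 1 3. rewrite Rabs_mult, (Rabs_pos_eq (/ harm M))
    by (left; now apply Rinv_0_lt_compat).
  apply Rmult_le_compat_r; [left; now apply Rinv_0_lt_compat|].
  unfold Rabs; destruct Rcase_abs; lra.
Qed.

(** * Advection by the cellular flow in Fourier space *)

Definition signs : list mode := [(1, 1); (1, -1); (-1, 1); (-1, -1)]%Z.

Definition padd (p s : mode) : mode := (fst p + fst s, snd p + snd s)%Z.
Definition psub (p s : mode) : mode := (fst p - fst s, snd p - snd s)%Z.

(** Up to the factor [- PI^2 A], this is the Fourier coefficient of the flow at [m s] applied to
    [2 pi i (k - m s)]. The terms [m s1^2] and [m s2^2] cancel, which is incompressibility; so the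
    coupling is the same at [k] and at [k - m s]. *)
Definition coupling (k s : mode) : R := IZR (fst s * fst k - snd s * snd k).

Definition advection (m : nat) (x : mode -> R) (k : mode) : R :=
  lsum signs (fun s => coupling k s *
    x (fst k - Z.of_nat m * fst s, snd k - Z.of_nat m * snd s)%Z).

(* The advection couples [k] only to the modes [site m k p], which make up its
   class modulo [m]. *)
Definition site (m : nat) (k p : mode) : mode :=
  (fst k + Z.of_nat m * fst p, snd k + Z.of_nat m * snd p)%Z.

(* The transpose of the advection, on the class of [k]. *)
Definition dual (m : nat) (k : mode) (phi : mode -> R) (p : mode) : R :=
  lsum signs (fun s => phi (padd p s) * coupling (site m k p) s).

Lemma in_signs s : In s signs ->
  (s = (1, 1) \/ s = (1, -1) \/ s = (-1, 1) \/ s = (-1, -1))%Z.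
Proof. cbn. intuition. Qed.

(** Summation by parts without boundary terms: [phi] lives in [box M], and one diagonal shift of it
    stays in [box (S M)]. *)
Lemma lsum_box_shift M phi (g : mode -> R) s :
  In s signs -> (forall p, phi p <> 0 -> In p (box M)) ->
  lsum (box (S M)) (fun p => phi p * g (psub p s)) =
  lsum (box (S M)) (fun p => phi (padd p s) * g p).
Proof.
  intros Hs Hphi.
  assert (E : forall p, padd (psub p s) s = p)
    by (intros [p1 p2]; unfold padd, psub; cbn; f_equal; lia).
  assert (E' : forall p, psub (padd p s) s = p)
    by (intros [p1 p2]; unfold padd, psub; cbn; f_equal; lia).
  rewrite (lsum_ext _ _ (fun p => (fun q => phi (padd q s) * g q) (psub p s)))
    by (intros p _; cbv beta; now rewrite E).
  rewrite <- (lsum_map (fun p => psub p s) (box (S M)) (fun q => phi (padd q s) * g q)).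
  apply lsum_support.
  - apply FinFun.Injective_map_NoDup, NoDup_box.
    intros p q H. now rewrite <- (E p), H, E.
  - apply NoDup_box.
  - intros p Hp.
    assert (B : In (padd p s) (box M)).
    { apply Hphi. intros Z. apply Hp. rewrite Z. ring. }
    apply in_box in B. unfold padd in B; cbn in B.
    apply in_signs in Hs. split; intros _.
    + apply in_box. destruct Hs as [->|[->|[->| ->]]]; cbn in B; lia.
    + apply in_map_iff. exists (padd p s). split; [apply E'|].
      apply in_box. unfold padd; cbn. lia.
Qed.

Lemma lsum_advection_dual m k M phi x :
  (forall p, phi p <> 0 -> In p (box M)) ->
  lsum (box (S M)) (fun p => phi p * advection m x (site m k p)) =
  lsum (box (S M)) (fun p => dual m k phi p * x (site m k p)).
Proof.
  intros Hphi.
  (* The coupling is moved to the site that [x] is read from; incompressibility makes it constant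
     along the shift. *)
  rewrite (lsum_ext _ _ (fun p => lsum signs (fun s =>
    phi p * (coupling (site m k (psub p s)) s * x (site m k (psub p s)))))).
  2:{ intros p _. unfold advection. rewrite <- lsum_scal. apply lsum_ext.
      intros s Hs. f_equal. f_equal.
      - unfold coupling. f_equal. unfold site, psub; cbn [fst snd].
        apply in_signs in Hs. destruct Hs as [->|[->|[->| ->]]]; cbn [fst snd]; ring.
      - f_equal. unfold site, psub; cbn [fst snd]. f_equal; ring. }
  rewrite lsum_swap.
  rewrite (lsum_ext signs _ (fun s => lsum (box (S M)) (fun p =>
    phi (padd p s) * (coupling (site m k p) s * x (site m k p))))).
  2:{ intros s Hs.
      apply (lsum_box_shift M phi (fun q => coupling (site m k q) s * x (site m k q)));
        auto. }
  rewrite lsum_swap. apply lsum_ext. intros p _. unfold dual.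
  rewrite (Rmult_comm (lsum _ _)), <- lsum_scal. apply lsum_ext. intros; ring.
Qed.

(* Advection moves columns by one, so with odd columns only the jump of the weight
   is felt just at column [0], where it is multiplied by the small number [fst k]. *)
Definition weight (M : nat) (p : mode) : R :=
  if ((0 <? fst p)%Z && Z.odd (fst p))%bool then cutoff M (znorm p) else 0.

(** Grouping the four signs shows a discrete transport operator [K1 d1 phi - K2 d2 phi]: only
    variations of [phi] between neighbouring rows or columns are felt. *)
Lemma dual_expand m k phi p : let K := site m k p in
  dual m k phi p =
    IZR (fst K) * ((phi (fst p + 1, snd p + 1)%Z - phi (fst p - 1, snd p + 1)%Z)
                 + (phi (fst p + 1, snd p - 1)%Z - phi (fst p - 1, snd p - 1)%Z))
  - IZR (snd K) * ((phi (fst p + 1, snd p + 1)%Z - phi (fst p + 1, snd p - 1)%Z)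
                 + (phi (fst p - 1, snd p + 1)%Z - phi (fst p - 1, snd p - 1)%Z)).
Proof.
  intros K. unfold dual. fold K. unfold lsum, coupling, padd, signs.
  cbn [map fold_right fst snd].
  rewrite !minus_IZR, !mult_IZR. change (fst p + -1)%Z with (fst p - 1)%Z.
  change (snd p + -1)%Z with (snd p - 1)%Z. ring.
Qed.

Lemma weight_bounds M p : 0 < harm M -> Rabs (weight M p) <= 1.
Proof.
  intros H. unfold weight. pose proof (cutoff_bounds M (znorm p) H).
  destruct (_ && _)%bool; [rewrite Rabs_pos_eq|rewrite Rabs_R0]; lra.
Qed.

Lemma weight_support M p : 0 < harm M -> weight M p <> 0 -> In p (box M).
Proof.
  intros H. unfold weight. destruct (_ && _)%bool; [|tauto].
  intros N. apply cutoff_support in N; auto. apply in_box. unfold znorm in N. lia.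
Qed.

(** Of the four neighbours of the origin, the two in column 1 have weight 1 and the two in column -1
    weight 0. The vertical differences vanish and the jump gives [2 k1]. *)
Lemma dual_weight_0 m k M : dual m k (weight M) (0, 0)%Z = 2 * IZR (fst k).
Proof.
  rewrite dual_expand. unfold weight, znorm. cbn.
  rewrite !cutoff_1, !Z.mul_0_r, !Z.add_0_r. ring.
Qed.

(** An odd column sees only even columns, where the weight is 0, and a negative column sees only
    zeros. A positive even column sees variations of the cutoff alone. Column 0 sees the jump, at
    most 2, multiplied by the first component, which there is still [fst k]: this is the last
    term. *)
Lemma dual_weight_bound m k M p : 0 < harm M -> p <> (0, 0)%Z ->
  Rabs (dual m k (weight M) p) <=
  6 / (IZR (znorm p) * harm M) *
    (Rabs (IZR (fst (site m k p))) + Rabs (IZR (snd (site m k p))))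
  + 2 * Rabs (IZR (fst k)).
Proof.
  intros H Hp. set (K := site m k p). destruct p as [n j].
  assert (Hr : (1 <= znorm (n, j))%Z).
  { unfold znorm; cbn. assert (n <> 0 \/ j <> 0)%Z; [|lia].
    destruct (Z.eq_dec n 0), (Z.eq_dec j 0); auto. subst. contradiction. }
  set (d := 3 / (IZR (znorm (n, j)) * harm M)).
  replace (6 / (IZR (znorm (n, j)) * harm M)) with (2 * d).
  2:{ unfold d. field. split; [lra|]. apply not_0_IZR. lia. }
  assert (C : forall a b,
    (Z.abs (fst a - n) <= 1)%Z -> (Z.abs (snd a - j) <= 1)%Z ->
    (Z.abs (fst b - n) <= 1)%Z -> (Z.abs (snd b - j) <= 1)%Z ->
    Rabs (cutoff M (znorm a) - cutoff M (znorm b)) <= d).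
  { intros [a1 a2] [b1 b2]. cbn [fst snd]. intros. apply cutoff_diff; auto;
      unfold znorm; cbn [fst snd]; lia. }
  assert (d0 : 0 <= d) by (eapply Rle_trans; [apply Rabs_pos|apply (C (n, j) (n, j)); cbn; lia]).
  pose proof (Rabs_pos (IZR (fst K))). pose proof (Rabs_pos (IZR (snd K))).
  pose proof (Rabs_pos (IZR (fst k))).
  assert (P : forall u v a b c e, Rabs a <= d -> Rabs b <= d -> Rabs c <= d -> Rabs e <= d ->
    Rabs (u * (a + b) - v * (c + e)) <= 2 * d * (Rabs u + Rabs v)).
  { intros u v a b c e Ha Hb Hc He.
    unfold Rminus. eapply Rle_trans; [apply Rabs_triang|].
    rewrite Rabs_Ropp, !Rabs_mult.
    pose proof (Rabs_triang a b). pose proof (Rabs_triang c e).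
    pose proof (Rabs_pos u). pose proof (Rabs_pos v). nra. }
  rewrite dual_expand. fold K. cbn [fst snd].
  destruct (Z.odd n) eqn:On.
  - assert (W : forall e l, (Z.odd e = true)%Z -> weight M (n + e, l)%Z = 0).
    { intros e l He. unfold weight. cbn [fst]. rewrite Z.odd_add, On, He. cbn.
      now rewrite andb_false_r. }
    unfold Z.sub. rewrite !W by reflexivity. rewrite !Rminus_diag, !Rplus_0_r, !Rmult_0_r, Rminus_0_r, Rabs_R0. nra.
  - assert (O1 : Z.odd (n + 1) = true) by (rewrite Z.odd_add, On; reflexivity).
    assert (O2 : Z.odd (n - 1) = true) by (rewrite Z.odd_sub, On; reflexivity).
    assert (V1 : forall l, (0 <= n)%Z -> weight M (n + 1, l)%Z = cutoff M (znorm (n + 1, l)%Z)).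
    { intros l Hn. unfold weight. cbn [fst]. rewrite O1.
      replace (0 <? n + 1)%Z with true by (symmetry; apply Z.ltb_lt; lia). reflexivity. }
    assert (V2 : forall l, (2 <= n)%Z -> weight M (n - 1, l)%Z = cutoff M (znorm (n - 1, l)%Z)).
    { intros l Hn. unfold weight. cbn [fst]. rewrite O2.
      replace (0 <? n - 1)%Z with true by (symmetry; apply Z.ltb_lt; lia). reflexivity. }
    assert (V3 : forall l, (n <= 0)%Z -> weight M (n - 1, l)%Z = 0).
    { intros l Hn. unfold weight. cbn [fst].
      replace (0 <? n - 1)%Z with false by (symmetry; apply Z.ltb_ge; lia). reflexivity. }
    assert (V4 : forall l, (n < 0)%Z -> weight M (n + 1, l)%Z = 0).
    { intros l Hn. unfold weight. cbn [fst].
      replace (0 <? n + 1)%Z with false by (symmetry; apply Z.ltb_ge; lia). reflexivity. }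
    assert (Z0 : Rabs 0 <= d) by (rewrite Rabs_R0; auto).
    destruct (Z.lt_trichotomy n 0) as [Hn|[Hn|Hn]].
    + rewrite !V3, !V4 by lia.
      rewrite !Rminus_diag, !Rplus_0_r, !Rmult_0_r, Rminus_0_r, Rabs_R0. nra.
    + rewrite !V3, !V1 by lia.
      assert (EK : fst K = fst k) by (unfold K, site; rewrite Hn; cbn; lia).
      rewrite EK in *. rewrite Rminus_diag, Rplus_0_r, !Rminus_0_r.
      set (c1 := cutoff M (znorm (n + 1, j + 1)%Z)).
      set (c2 := cutoff M (znorm (n + 1, j - 1)%Z)).
      assert (Rabs (c1 - c2) <= d) by (apply C; cbn; lia).
      assert (B1 : 0 <= c1 <= 1) by (apply cutoff_bounds; auto).
      assert (B2 : 0 <= c2 <= 1) by (apply cutoff_bounds; auto).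
      unfold Rminus at 1. eapply Rle_trans; [apply Rabs_triang|].
      rewrite Rabs_Ropp, !Rabs_mult, (Rabs_pos_eq (c1 + c2)) by lra. nra.
    + assert (2 <= n)%Z.
      { destruct (Z.eq_dec n 1) as [->|]; [discriminate|lia]. }
      rewrite !V1, !V2 by lia.
      eapply Rle_trans; [apply P; apply C; cbn; lia|]. lra.
Qed.

Definition pswap (p : mode) : mode := (snd p, fst p).

(** Exchanging the axes reverses the rotation in the cells, hence the sign. It reduces the modes
    with [|k2| > |k1|] to the other case. *)
Lemma dual_pswap m k phi p :
  dual m k (fun q => phi (pswap q)) p = - dual m (pswap k) phi (pswap p).
Proof. rewrite !dual_expand. unfold pswap, site. cbn [fst snd]. ring. Qed.

(** A shell contributes [8r] times [36/(r harm M)^2], so the sum is [288 harm (S M) / harm M ^ 2].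
    Doubling 288 absorbs the extra shell [S M]. *)
Lemma sum_cutoff_sqr_le M : 1 <= harm M ->
  lsum (pbox (S M)) (fun p => (6 / (IZR (znorm p) * harm M)) ^ 2) <= 576 / harm M.
Proof.
  intros H.
  rewrite (lsum_pbox_shells (S M) (fun r => (6 / (IZR r * harm M)) ^ 2)).
  rewrite (lsum_ext _ _ (fun r => 288 / harm M ^ 2 * / INR r)).
  2:{ intros r Hr. apply in_seq in Hr. rewrite <- INR_IZR_INZ. field.
      split; first [lra | apply not_0_INR; lia]. }
  rewrite lsum_scal. fold (harm (S M)). rewrite harm_S.
  assert (/ INR (S M) <= 1).
  { rewrite <- Rinv_1. apply Rinv_le_contravar; [lra|]. apply (le_INR 1). lia. }
  apply (Rmult_le_reg_r (harm M ^ 2)); [nra|].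
  replace (288 / harm M ^ 2 * (harm M + / INR (S M)) * harm M ^ 2)
    with (288 * (harm M + / INR (S M))) by (field; split; first [lra | apply not_0_INR; lia]).
  replace (576 / harm M * harm M ^ 2) with (576 * harm M) by (field; lra). lra.
Qed.

(** [M] and the envelope [o] are fixed before [m] and [k], because [m] will have to beat the number
    of sites. [h] is the dominant component of [k] up to sign, so that all couplings at [k] are at
    most [2 |h|]. *)
Lemma weight_exists kappa : 0 < kappa ->
  exists (M : nat) (o : mode -> R),
    lsum (pbox (S M)) (fun p => o p ^ 2) <= kappa /\
    forall (m : nat) (k : mode), k <> (0, 0)%Z ->
    exists (phi : mode -> R) (h : R),
      1 <= Rabs h /\ Rabs (IZR (fst k)) <= Rabs h /\ Rabs (IZR (snd k)) <= Rabs h /\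
      (forall p, Rabs (phi p) <= 1) /\ phi (0, 0)%Z = 0 /\
      (forall p, phi p <> 0 -> In p (box M)) /\
      dual m k phi (0, 0)%Z = 2 * h /\
      (forall p, p <> (0, 0)%Z ->
        Rabs (dual m k phi p) <=
        o p * (Rabs (IZR (fst (site m k p))) + Rabs (IZR (snd (site m k p))))
        + 2 * Rabs h).
Proof.
  intros Hk. destruct (harm_unbounded (Rmax 1 (576 / kappa))) as [M HM].
  assert (H1 : 1 <= harm M) by (eapply Rle_trans; [apply Rmax_l|exact HM]).
  assert (H2 : 576 / kappa <= harm M) by (eapply Rle_trans; [apply Rmax_r|exact HM]).
  assert (H0 : 0 < harm M) by lra.
  exists M, (fun p => 6 / (IZR (znorm p) * harm M)). split.
  { eapply Rle_trans; [now apply sum_cutoff_sqr_le|].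
    apply (Rmult_le_reg_r (harm M)); auto. unfold Rdiv at 1.
    rewrite Rmult_assoc, Rinv_l, Rmult_1_r by lra.
    apply (Rmult_le_compat_l kappa) in H2; [|lra].
    replace (kappa * (576 / kappa)) with 576 in H2 by (field; lra). lra. }
  intros m k Hk0.
  assert (A : forall z, z <> 0%Z -> 1 <= Rabs (IZR z))
    by (intros z Hz; rewrite <- abs_IZR; apply IZR_le; lia).
  assert (Z0 : weight M (0, 0)%Z = 0) by reflexivity.
  destruct (Z.le_gt_cases (Z.abs (snd k)) (Z.abs (fst k))) as [L|L].
  - exists (weight M), (IZR (fst k)).
    repeat split; auto using weight_bounds, weight_support, dual_weight_0,
      dual_weight_bound, Rle_refl.
    + apply A. intros E. apply Hk0. destruct k; cbn in *. f_equal; lia.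
    + rewrite <- !abs_IZR. now apply IZR_le.
  - exists (fun p => weight M (pswap p)), (- IZR (snd k)).
    rewrite Rabs_Ropp.
    repeat split; auto using weight_bounds, Rle_refl.
    + apply A. lia.
    + rewrite <- !abs_IZR. apply IZR_le. lia.
    + intros p Hp. apply weight_support in Hp; auto.
      rewrite in_box in *. unfold pswap in Hp; cbn in Hp. tauto.
    + rewrite dual_pswap. change (pswap (0, 0)%Z) with (0, 0)%Z.
      rewrite dual_weight_0. cbn [fst pswap]. ring.
    + intros p Hp. rewrite dual_pswap, Rabs_Ropp.
      assert (Hp' : pswap p <> (0, 0)%Z).
      { intros E. apply Hp. destruct p; unfold pswap in E; cbn in E. now inversion E. }
      pose proof (dual_weight_bound m (pswap k) M (pswap p) H0 Hp') as D.
      replace (znorm (pswap p)) with (znorm p) in D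
        by (unfold znorm, pswap; cbn; apply Z.max_comm).
      replace (fst (site m (pswap k) (pswap p))) with (snd (site m k p)) in D by reflexivity.
      replace (snd (site m (pswap k) (pswap p))) with (fst (site m k p)) in D by reflexivity.
      cbn [fst pswap] in D. lra.
Qed.

(** * Correctors at the low modes *)

Definition ksq (k : mode) : R := IZR (fst k) ^ 2 + IZR (snd k) ^ 2.

Lemma ksq_nonneg k : 0 <= ksq k.
Proof. unfold ksq. pose proof (pow2_ge_0 (IZR (fst k))). pose proof (pow2_ge_0 (IZR (snd k))). lra. Qed.

(** The quarter keeps the classes modulo [m] of distinct low modes disjoint and puts every other
    member of such a class at frequency at least [m/2]; the remaining nonzero modes still have
    frequency at least [m/4]. *)
Definition low (m : nat) (k : mode) : bool :=
  (negb (zero_mode k) && ((4 * Z.abs (fst k) <=? Z.of_nat m)%Z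
                          && (4 * Z.abs (snd k) <=? Z.of_nat m)%Z))%bool.

Lemma lowP m k : low m k = true <->
  k <> (0, 0)%Z /\ (4 * Z.abs (fst k) <= Z.of_nat m)%Z /\ (4 * Z.abs (snd k) <= Z.of_nat m)%Z.
Proof.
  unfold low. rewrite !andb_true_iff, !Z.leb_le, negb_true_iff,
    <- not_true_iff_false, zero_modeP. tauto.
Qed.

Lemma ksq_ge z1 z2 (c : Z) m : (0 < c)%Z ->
  (Z.of_nat m <= c * Z.abs z1 \/ Z.of_nat m <= c * Z.abs z2)%Z ->
  INR m ^ 2 <= IZR c ^ 2 * ksq (z1, z2).
Proof.
  intros Hc H. unfold ksq; cbn [fst snd].
  assert (B : forall z, (Z.of_nat m <= c * Z.abs z)%Z -> INR m ^ 2 <= IZR c ^ 2 * IZR z ^ 2).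
  { intros z Hz. apply IZR_le in Hz. rewrite <- INR_IZR_INZ, mult_IZR, abs_IZR in Hz.
    rewrite <- (pow2_abs (IZR z)), <- Rpow_mult_distr.
    apply pow_incr. split; [apply pos_INR|exact Hz]. }
  assert (0 < IZR c) by (now apply IZR_lt).
  destruct H as [H|H]; apply B in H; pose proof (pow2_ge_0 (IZR z1));
    pose proof (pow2_ge_0 (IZR z2)); pose proof (pow2_ge_0 (IZR c)); nra.
Qed.

Lemma low_site_ksq m k p : low m k = true -> p <> (0, 0)%Z ->
  INR m ^ 2 <= 4 * ksq (site m k p).
Proof.
  rewrite lowP. intros (_ & H1 & H2) Hp. destruct p as [p1 p2].
  unfold site; cbn [fst snd].
  replace 4 with (IZR 2 ^ 2) by (cbn; ring).
  apply ksq_ge; [lia|].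
  assert (N : (p1 <> 0 \/ p2 <> 0)%Z).
  { destruct (Z.eq_dec p1 0), (Z.eq_dec p2 0); auto. subst; contradiction. }
  destruct N; [left|right]; nia.
Qed.

Lemma site_0 m k : site m k (0, 0)%Z = k.
Proof. destruct k; unfold site; cbn. f_equal; lia. Qed.

Lemma lsum_signs_le m k M (x : mode -> R) :
  lsum signs (fun s => Rabs (x (fst k - Z.of_nat m * fst s, snd k - Z.of_nat m * snd s)%Z))
  <= lsum (pbox (S M)) (fun p => Rabs (x (site m k p))).
Proof.
  set (neg := fun s : mode => (- fst s, - snd s)%Z).
  rewrite (lsum_ext _ _ (fun s => Rabs (x (site m k (neg s))))).
  2:{ intros s _. do 2 f_equal. unfold site, neg; cbn [fst snd]. f_equal; ring. }
  rewrite <- (lsum_map neg signs (fun p => Rabs (x (site m k p)))).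
  apply lsum_incl.
  - unfold neg, signs. cbn. repeat (apply NoDup_cons; [cbn; intuition congruence|]). apply NoDup_nil.
  - apply NoDup_pbox.
  - intros p Hp. apply in_pbox. rewrite in_box.
    unfold neg in Hp. cbn in Hp. destruct Hp as [<-|[<-|[<-|[<-|[]]]]]; cbn [fst snd]; (split; [lia|discriminate]).
  - intros; apply Rabs_pos.
Qed.

(** Two weighted Young inequalities. The weights make the coefficients of [c ^ 2] add up, over at
    most [n] sites with [o ^ 2] summing to at most [kappa], to at most [1/2 + 1/2]. *)
Lemma corrector_young (o s q c u n kappa : R) :
  0 < n -> 0 < kappa -> 0 <= s -> s ^ 2 <= 2 * q -> 0 <= c -> 0 <= u ->
  (Rabs o * s + 2) * (c * u) <=
  (o ^ 2 / (2 * kappa) + / (2 * n)) * c ^ 2 + (kappa * q + 2 * n) * u ^ 2.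
Proof.
  intros Hn Hk Hs Hq Hc Hu.
  assert (A1 : Rabs o * s * (c * u) <= o ^ 2 / (2 * kappa) * c ^ 2 + kappa * q * u ^ 2).
  { apply (Rmult_le_reg_l (2 * kappa)); [lra|].
    replace (2 * kappa * (o ^ 2 / (2 * kappa) * c ^ 2 + kappa * q * u ^ 2))
      with (o ^ 2 * c ^ 2 + 2 * kappa ^ 2 * q * u ^ 2) by (field; lra).
    rewrite <- (pow2_abs o).
    pose proof (pow2_ge_0 (Rabs o * c - kappa * s * u)).
    assert (kappa ^ 2 * u ^ 2 * s ^ 2 <= kappa ^ 2 * u ^ 2 * (2 * q)).
    { apply Rmult_le_compat_l; auto.
      rewrite <- Rpow_mult_distr. apply pow2_ge_0. }
    nra. }
  assert (A2 : 2 * (c * u) <= / (2 * n) * c ^ 2 + 2 * n * u ^ 2).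
  { apply (Rmult_le_reg_l (2 * n)); [lra|].
    replace (2 * n * (/ (2 * n) * c ^ 2 + 2 * n * u ^ 2))
      with (c ^ 2 + 4 * n ^ 2 * u ^ 2) by (field; lra).
    pose proof (pow2_ge_0 (c - 2 * n * u)). nra. }
  lra.
Qed.

(** After transposition the right side is [2 x_k^2 + x_k e / h + b f / h], with [e] and [f]
    supported off [k]. Young's inequality gives up one [x_k^2] for the middle term; the two other
    costs [8 n / m^2] come from modes off [k], which are of high frequency. *)
Lemma corrector_rate m M k phi h o kappa (x : mode -> R) :
  0 < kappa -> (1 <= m)%nat -> low m k = true ->
  lsum (pbox (S M)) (fun p => o p ^ 2) <= kappa ->
  1 <= Rabs h -> Rabs (IZR (fst k)) <= Rabs h -> Rabs (IZR (snd k)) <= Rabs h ->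
  (forall p, Rabs (phi p) <= 1) -> phi (0, 0)%Z = 0 ->
  (forall p, phi p <> 0 -> In p (box M)) ->
  dual m k phi (0, 0)%Z = 2 * h ->
  (forall p, p <> (0, 0)%Z -> Rabs (dual m k phi p) <=
    o p * (Rabs (IZR (fst (site m k p))) + Rabs (IZR (snd (site m k p)))) + 2 * Rabs h) ->
  x k ^ 2 - (kappa + 16 * INR (length (box (S M))) / INR m ^ 2) *
    lsum (box (S M)) (fun p => ksq (site m k p) * x (site m k p) ^ 2)
  <= (advection m x k * lsum (box (S M)) (fun p => phi p * x (site m k p)) +
      x k * lsum (box (S M)) (fun p => phi p * advection m x (site m k p))) / h.
Proof.
  intros Hkap Hm Hlow Ho Hh Hk1 Hk2 Hphi Hphi0 Hsupp HD0 HD.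
  set (L := pbox (S M)). set (n := INR (length (box (S M)))).
  set (H := lsum L (fun p => ksq (site m k p) * x (site m k p) ^ 2)).
  set (Q := lsum L (fun p => Rabs (x (site m k p)))).
  set (X := lsum L (fun p => x (site m k p) ^ 2)).
  assert (Hh0 : h <> 0) by (intros E; rewrite E, Rabs_R0 in Hh; lra).
  assert (Hm0 : 0 < INR m) by (apply lt_0_INR; lia).
  assert (Hn0 : 0 < n) by (apply lt_0_INR; rewrite length_box; lia).
  assert (HnL : INR (length L) <= n) by (apply le_INR, filter_length_le).
  assert (HH : H <= lsum (box (S M)) (fun p => ksq (site m k p) * x (site m k p) ^ 2)).
  { apply lsum_pbox_le. apply Rmult_le_pos; [apply ksq_nonneg|apply pow2_ge_0]. }
  assert (H0 : 0 <= H).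
  { apply lsum_nonneg; intros. apply Rmult_le_pos; [apply ksq_nonneg|apply pow2_ge_0]. }
  assert (HX0 : 0 <= X) by (apply lsum_nonneg; intros; apply pow2_ge_0).
  (* The gain of [m^(-2)]: sites other than [k] have frequency at least [m/2]. *)
  assert (HX : X <= 4 / INR m ^ 2 * H).
  { unfold X, H. rewrite <- lsum_scal. apply lsum_le. intros p Hp.
    apply in_pbox in Hp. pose proof (low_site_ksq m k p Hlow (proj2 Hp)) as B.
    apply (Rmult_le_reg_l (INR m ^ 2)); [nra|].
    replace (INR m ^ 2 * (4 / INR m ^ 2 * (ksq (site m k p) * x (site m k p) ^ 2)))
      with (4 * ksq (site m k p) * x (site m k p) ^ 2) by (field; lra).
    apply Rmult_le_compat_r; [apply pow2_ge_0|exact B]. }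
  assert (HQ0 : 0 <= Q) by (apply lsum_nonneg; intros; apply Rabs_pos).
  assert (HQ : Q ^ 2 <= n * X).
  { eapply Rle_trans; [apply lsum_sqr_le|].
    rewrite (lsum_ext _ _ (fun p => x (site m k p) ^ 2)) by (intros; apply pow2_abs).
    apply Rmult_le_compat_r; auto. }
  rewrite (lsum_advection_dual m k M phi x Hsupp), !lsum_box_pbox, site_0, HD0, Hphi0, Rmult_0_l, Rplus_0_l.
  fold L H. set (f := lsum L (fun p => phi p * x (site m k p))).
  set (e := lsum L (fun p => dual m k phi p * x (site m k p))).
  set (b := advection m x k).
  assert (Hf : Rabs f <= Q).
  { eapply Rle_trans; [apply lsum_Rabs|]. apply lsum_le. intros p _.
    rewrite Rabs_mult. rewrite <- (Rmult_1_l (Rabs (x _))) at 2.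
    apply Rmult_le_compat_r; auto. apply Rabs_pos. }
  (* Each coupling at [k] is at most [|k1| + |k2| <= 2 |h|], so dividing by [h] leaves a bound
     uniform in [k]. *)
  assert (Hb : Rabs b <= 2 * Rabs h * Q).
  { eapply Rle_trans; [apply lsum_Rabs|].
    eapply Rle_trans; [|apply Rmult_le_compat_l; [pose proof (Rabs_pos h); lra
                                                |apply (lsum_signs_le m k M x)]].
    rewrite <- lsum_scal. apply lsum_le. intros s Hs. rewrite Rabs_mult.
    apply Rmult_le_compat_r; [apply Rabs_pos|]. unfold coupling.
    apply in_signs in Hs. rewrite minus_IZR, !mult_IZR.
    eapply Rle_trans; [apply Rabs_triang|]. rewrite Rabs_Ropp, !Rabs_mult.
    destruct Hs as [->|[->|[->| ->]]]; cbn [fst snd];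
      rewrite ?Rabs_R1, <- ?abs_IZR; cbn [Z.abs]; rewrite ?abs_IZR; lra. }
  assert (Hbf : Rabs (b * f / h) <= 8 * n / INR m ^ 2 * H).
  { unfold Rdiv at 1. rewrite !Rabs_mult, Rabs_inv.
    apply Rle_trans with (2 * Q ^ 2).
    - apply (Rmult_le_reg_r (Rabs h)); [lra|].
      rewrite Rmult_assoc, Rinv_l, Rmult_1_r by lra.
      pose proof (Rabs_pos b). pose proof (Rabs_pos f).
      apply Rle_trans with (2 * Rabs h * Q * Q); [|lra].
      apply Rmult_le_compat; auto.
    - apply Rle_trans with (2 * (n * X)); [lra|].
      replace (8 * n / INR m ^ 2 * H) with (2 * (n * (4 / INR m ^ 2 * H))) by (field; lra).
      apply Rmult_le_compat_l; [lra|]. apply Rmult_le_compat_l; lra. }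
  assert (Hae : Rabs (x k * e / h) <= x k ^ 2 + (kappa + 8 * n / INR m ^ 2) * H).
  { apply Rle_trans with (lsum L (fun p =>
      (o p ^ 2 / (2 * kappa) + / (2 * n)) * x k ^ 2 +
      (kappa * ksq (site m k p) + 2 * n) * x (site m k p) ^ 2)).
    - replace (x k * e / h) with (lsum L (fun p => x k / h * (dual m k phi p * x (site m k p))))
        by (rewrite lsum_scal; fold e; field; auto).
      eapply Rle_trans; [apply lsum_Rabs|]. apply lsum_le. intros p Hp.
      apply in_pbox in Hp. destruct Hp as [_ Hp]. specialize (HD p Hp).
      set (K1 := IZR (fst (site m k p))) in *. set (K2 := IZR (snd (site m k p))) in *.
      unfold Rdiv at 1. rewrite !Rabs_mult, Rabs_inv.
      rewrite <- (pow2_abs (x k)), <- (pow2_abs (x (site m k p))).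
      eapply Rle_trans; [|apply (corrector_young (o p) (Rabs K1 + Rabs K2))]; auto.
      + apply (Rmult_le_reg_r (Rabs h)); [lra|].
        replace (Rabs (x k) * / Rabs h * (Rabs (dual m k phi p) * Rabs (x (site m k p))) * Rabs h)
          with (Rabs (dual m k phi p) * (Rabs (x k) * Rabs (x (site m k p)))) by (field; lra).
        replace ((Rabs (o p) * (Rabs K1 + Rabs K2) + 2) * (Rabs (x k) * Rabs (x (site m k p))) * Rabs h)
          with ((Rabs (o p) * (Rabs K1 + Rabs K2) + 2) * Rabs h * (Rabs (x k) * Rabs (x (site m k p)))) by ring.
        apply Rmult_le_compat_r; [apply Rmult_le_pos; apply Rabs_pos|].
        eapply Rle_trans; [exact HD|].
        pose proof (Rle_abs (o p)). pose proof (Rabs_pos K1). pose proof (Rabs_pos K2).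
        pose proof (Rabs_pos (o p)).
        assert (o p * (Rabs K1 + Rabs K2) <= Rabs (o p) * (Rabs K1 + Rabs K2)) by nra.
        assert (0 <= Rabs (o p) * (Rabs K1 + Rabs K2)) by nra. nra.
      + pose proof (Rabs_pos K1). pose proof (Rabs_pos K2). lra.
      + unfold ksq. fold K1 K2. rewrite <- (pow2_abs K1), <- (pow2_abs K2).
        pose proof (pow2_ge_0 (Rabs K1 - Rabs K2)). nra.
      + apply Rabs_pos.
      + apply Rabs_pos.
    - rewrite lsum_plus.
      apply Rplus_le_compat.
      + rewrite (lsum_ext _ _ (fun p => x k ^ 2 * (/ (2 * kappa) * o p ^ 2 + / (2 * n))))
          by (intros; field; lra).
        rewrite lsum_scal, lsum_plus, lsum_scal, lsum_const.
        rewrite <- (Rmult_1_r (x k ^ 2)) at 2.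
        apply Rmult_le_compat_l; [apply pow2_ge_0|].
        assert (/ (2 * kappa) * lsum L (fun p => o p ^ 2) <= / 2).
        { apply (Rmult_le_reg_l (2 * kappa)); [lra|].
          rewrite <- Rmult_assoc, Rinv_r, Rmult_1_l by lra. fold L in Ho. lra. }
        assert (INR (length L) * / (2 * n) <= / 2).
        { apply (Rmult_le_reg_r (2 * n)); [lra|].
          rewrite Rmult_assoc, Rinv_l, Rmult_1_r by lra. lra. }
        lra.
      + rewrite (lsum_ext _ _ (fun p => kappa * (ksq (site m k p) * x (site m k p) ^ 2)
          + 2 * n * x (site m k p) ^ 2)) by (intros; ring).
        rewrite lsum_plus, !lsum_scal. fold H X.
        replace ((kappa + 8 * n / INR m ^ 2) * H)
          with (kappa * H + 2 * n * (4 / INR m ^ 2 * H)) by (field; lra).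
        apply Rplus_le_compat_l, Rmult_le_compat_l; lra. }
  replace ((b * f + x k * (2 * h * x k + e)) / h)
    with (2 * x k ^ 2 + x k * e / h + b * f / h) by (field; auto).
  apply Rabs_le_between in Hbf. apply Rabs_le_between in Hae.
  set (HB := ksq k * x k ^ 2 + H) in *.
  assert (HHB : H <= HB) by (rewrite lsum_box_pbox, site_0 in HH; exact HH).
  assert (HE : (kappa + 16 * n / INR m ^ 2) * H <= (kappa + 16 * n / INR m ^ 2) * HB).
  { apply Rmult_le_compat_l; auto.
    assert (0 <= 16 * n / INR m ^ 2) by (apply Rdiv_le_0_compat; [lra|nra]). lra. }
  replace ((kappa + 16 * n / INR m ^ 2) * H)
    with ((kappa + 8 * n / INR m ^ 2) * H + 8 * n / INR m ^ 2 * H) in HE by (field; lra).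
  lra.
Qed.

(** The system for the real part or the imaginary part. The damping [D] is kept abstract: later
    arguments use only lower bounds on it and its size on finitely many modes. *)
Definition evolves (m : nat) (A gamma : R) (D : mode -> R) (x : R -> mode -> R) (t : R) : Prop :=
  forall k, is_derive (fun u => x u k) t
    (PI ^ 2 * A * advection m (x t) k - gamma * D k * x t k).

Lemma PI2_ge_1 : 1 <= PI ^ 2.
Proof. pose proof PI2_3_2. unfold PI2 in *. nra. Qed.

Lemma lsum_mul_le (l : list mode) (c x : mode -> R) a B :
  0 <= B -> (forall p, In p l -> Rabs (c p) <= B) ->
  a ^ 2 <= lsum l (fun p => x p ^ 2) ->
  Rabs (a * lsum l (fun p => c p * x p)) <=
  INR (length l) * B * lsum l (fun p => x p ^ 2).
Proof.
  intros HB Hc Ha. set (X := lsum l (fun p => x p ^ 2)) in *.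
  rewrite <- lsum_scal. eapply Rle_trans; [apply lsum_Rabs|].
  apply Rle_trans with (lsum l (fun _ => B * X)); [|rewrite lsum_const; lra].
  apply lsum_le. intros p Hp.
  assert (Hx : x p ^ 2 <= X)
    by (apply (lsum_term l (fun p => x p ^ 2)); auto; intros; apply pow2_ge_0).
  rewrite !Rabs_mult.
  replace (Rabs a * (Rabs (c p) * Rabs (x p))) with (Rabs (c p) * (Rabs a * Rabs (x p))) by ring.
  apply Rmult_le_compat; auto using Rabs_pos.
  - apply Rmult_le_pos; apply Rabs_pos.
  - rewrite <- (pow2_abs a) in Ha. rewrite <- (pow2_abs (x p)) in Hx.
    pose proof (pow2_ge_0 (Rabs a - Rabs (x p))). nra.
Qed.

(** Dividing by [PI^2 A h] cancels the factor of the advection, so its contribution is that of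
    [corrector_rate]. The damping keeps the factor [1/A] and goes into [C / A], with [C] chosen
    before [A] and [k]. *)
Lemma corrector_exists kappa : 0 < kappa -> exists M : nat,
  forall (m : nat) (gamma : R) (D : mode -> R),
  (1 <= m)%nat -> 0 <= gamma -> (forall k, 0 <= D k) ->
  exists C, 0 < C /\ forall A, 0 < A -> forall k, low m k = true ->
  exists Y : (mode -> R) -> R,
    (forall x, Rabs (Y x) <= C / A * lsum (box (S M)) (fun p => x (site m k p) ^ 2)) /\
    forall x t, evolves m A gamma D x t -> exists dY,
      is_derive (fun u => Y (x u)) t dY /\
      x t k ^ 2 - (kappa + 16 * INR (length (box (S M))) / INR m ^ 2) *
        lsum (box (S M)) (fun p => ksq (site m k p) * x t (site m k p) ^ 2)
      - C / A * lsum (box (S M)) (fun p => x t (site m k p) ^ 2) <= dY.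
Proof.
  intros Hkap. destruct (weight_exists kappa Hkap) as (M & o & Ho & W).
  exists M. intros m gamma D Hm Hg HD.
  set (n := INR (length (box (S M)))).
  assert (Hn0 : 0 < n) by (apply lt_0_INR; rewrite length_box; lia).
  (* A crude bound for the damping at every site used: these have coordinates at most
     [m/4 + m (M + 1)]. *)
  set (Dm := lsum (box (m * (M + 2))) D).
  assert (HDm0 : 0 <= Dm) by (apply lsum_nonneg; auto).
  pose proof PI2_ge_1 as Hpi.
  (* The 1 serves the bound on [Y], the rest the damping of the two factors of [Y]. *)
  exists (n * (1 + 2 * gamma * Dm)). split.
  { assert (0 <= gamma * Dm) by nra. nra. }
  intros A HA k Hlow.
  assert (Hk := Hlow). apply lowP in Hk. destruct Hk as (Hk0 & Hk1 & Hk2).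
  destruct (W m k Hk0) as (phi & h & Hh & Hh1 & Hh2 & Hphi & Hphi0 & Hsupp & HD0 & HDp).
  assert (Hh0 : h <> 0) by (intros E; rewrite E, Rabs_R0 in Hh; lra).
  assert (HDm : forall p, In p (box (S M)) -> 0 <= D (site m k p) <= Dm).
  { intros p Hp. split; [apply HD|]. apply (lsum_term _ D); auto.
    rewrite in_box in *. unfold site; cbn [fst snd]. split; nia. }
  assert (H00 : In (0, 0)%Z (box (S M))) by (apply in_box; cbn; lia).
  set (X := fun x : mode -> R => lsum (box (S M)) (fun p => x (site m k p) ^ 2)).
  assert (HX0 : forall x, 0 <= X x) by (intros; apply lsum_nonneg; intros; apply pow2_ge_0).
  assert (HaX : forall x, x k ^ 2 <= X x).
  { intros x. rewrite <- (site_0 m k) at 1.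
    apply (lsum_term _ (fun p => x (site m k p) ^ 2)); auto. intros; apply pow2_ge_0. }
  (* [PI^2] and [|h|] are at least 1, so the divisor has modulus at least [A] whatever [k] is. *)
  assert (DIV : forall u v, Rabs u <= v -> Rabs (u / (PI ^ 2 * A * h)) <= v / A).
  { intros u v Huv. unfold Rdiv. rewrite Rabs_mult, Rabs_inv, !Rabs_mult.
    rewrite (Rabs_pos_eq (PI ^ 2)), (Rabs_pos_eq A) by lra.
    assert (A <= PI ^ 2 * A * Rabs h).
    { replace A with (1 * A * 1) at 1 by ring.
      apply Rmult_le_compat; nra. }
    apply Rmult_le_compat; auto using Rabs_pos.
    - left; apply Rinv_0_lt_compat; lra.
    - apply Rinv_le_contravar; auto. }
  exists (fun x => x k * lsum (box (S M)) (fun p => phi p * x (site m k p)) / (PI ^ 2 * A * h)).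
  split.
  - intros x. eapply Rle_trans.
    + apply DIV, (lsum_mul_le _ _ (fun p => x (site m k p)) _ 1);
        first [lra | apply HaX | auto].
    + fold (X x) n. unfold Rdiv. rewrite Rmult_assoc, (Rmult_comm (X x)), <- Rmult_assoc.
      apply Rmult_le_compat_r; auto. apply Rmult_le_compat_r; [left; now apply Rinv_0_lt_compat|].
      apply Rmult_le_compat_l; [lra|]. assert (0 <= gamma * Dm) by nra. lra.
  - intros x t Hx.
    set (f := fun u => lsum (box (S M)) (fun p => phi p * x u (site m k p))).
    set (fa := lsum (box (S M)) (fun p => phi p * advection m (x t) (site m k p))).
    set (fd := lsum (box (S M)) (fun p => phi p * D (site m k p) * x t (site m k p))).
    assert (Df : is_derive f t (PI ^ 2 * A * fa - gamma * fd)).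
    { unfold fa, fd, Rminus. rewrite Ropp_mult_distr_l, <- !lsum_scal, <- lsum_plus.
      apply (is_derive_lsum (box (S M)) (fun p u => phi p * x u (site m k p))).
      intros p _.
      replace (PI ^ 2 * A * (phi p * advection m (x t) (site m k p)) +
        - gamma * (phi p * D (site m k p) * x t (site m k p)))
        with (phi p * (PI ^ 2 * A * advection m (x t) (site m k p)
               - gamma * D (site m k p) * x t (site m k p))) by ring.
      apply (is_derive_scal (fun u => x u (site m k p))). apply Hx. }
    exists ((advection m (x t) k * f t + x t k * fa) / h +
      - gamma * (x t k * lsum (box (S M)) (fun p => (D k * phi p + phi p * D (site m k p)) * x t (site m k p)))
        / (PI ^ 2 * A * h)).
    split.
    + apply (is_derive_ext (fun u => / (PI ^ 2 * A * h) * (x u k * f u))).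
      { intros u. apply Rmult_comm. }
      replace ((advection m (x t) k * f t + x t k * fa) / h +
        - gamma * (x t k * lsum (box (S M)) (fun p => (D k * phi p + phi p * D (site m k p)) * x t (site m k p)))
        / (PI ^ 2 * A * h)) with
        (/ (PI ^ 2 * A * h) * ((PI ^ 2 * A * advection m (x t) k - gamma * D k * x t k) * f t
          + x t k * (PI ^ 2 * A * fa - gamma * fd))).
      { apply (is_derive_scal (fun u => x u k * f u)).
        apply (is_derive_mult (fun u => x u k) f); auto. exact Rmult_comm. }
      rewrite (lsum_ext _ (fun p => (D k * phi p + phi p * D (site m k p)) * x t (site m k p))
        (fun p => D k * (phi p * x t (site m k p)) + phi p * D (site m k p) * x t (site m k p)))
        by (intros; ring).
      rewrite lsum_plus, lsum_scal. fold (f t) fd. field.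
      repeat split; auto using PI_neq0; lra.
    + pose proof (corrector_rate m M k phi h o kappa (x t) Hkap Hm Hlow Ho Hh Hh1 Hh2
        Hphi Hphi0 Hsupp HD0 HDp) as Rt.
      fold (f t) fa n in Rt. fold n (X (x t)).
      set (g := lsum (box (S M)) (fun p => (D k * phi p + phi p * D (site m k p)) * x t (site m k p))).
      assert (Hg' : Rabs (x t k * g) <= n * (2 * Dm) * X (x t)).
      { apply (lsum_mul_le _ _ (fun p => x t (site m k p))); [lra| |apply HaX].
        intros p Hp. pose proof (HDm p Hp). pose proof (HDm _ H00) as HDk. rewrite site_0 in HDk.
        replace (D k * phi p + phi p * D (site m k p)) with (phi p * (D k + D (site m k p))) by ring.
        rewrite Rabs_mult, (Rabs_pos_eq (D k + _)) by lra.
        pose proof (Hphi p). pose proof (Rabs_pos (phi p)). nra. }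
      assert (Hg'' : Rabs (- gamma * (x t k * g)) <= gamma * (n * (2 * Dm) * X (x t))).
      { rewrite Rabs_mult, Rabs_Ropp, (Rabs_pos_eq gamma) by auto. now apply Rmult_le_compat_l. }
      apply DIV, Rabs_le_between in Hg''.
      assert (gamma * (n * (2 * Dm) * X (x t)) / A <= n * (1 + 2 * gamma * Dm) / A * X (x t)).
      { replace (n * (1 + 2 * gamma * Dm) / A * X (x t))
          with (n * (1 + 2 * gamma * Dm) * X (x t) / A) by (field; lra).
        apply Rmult_le_compat_r; [left; now apply Rinv_0_lt_compat|].
        specialize (HX0 (x t)). nra. }
      lra.
Qed.

(** The one-mode constant [C] does not depend on [k], so adding correctors keeps it. *)
Lemma correctors_exist kappa : 0 < kappa -> exists M : nat,
  forall (m : nat) (gamma : R) (D : mode -> R),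
  (1 <= m)%nat -> 0 <= gamma -> (forall k, 0 <= D k) ->
  exists C, 0 < C /\ forall A, 0 < A -> forall l, (forall k, In k l -> low m k = true) ->
  exists Y : (mode -> R) -> R,
    (forall x, Rabs (Y x) <= C / A *
       lsum l (fun k => lsum (box (S M)) (fun p => x (site m k p) ^ 2))) /\
    forall x t, evolves m A gamma D x t -> exists dY,
      is_derive (fun u => Y (x u)) t dY /\
      lsum l (fun k => x t k ^ 2) - (kappa + 16 * INR (length (box (S M))) / INR m ^ 2) *
        lsum l (fun k => lsum (box (S M)) (fun p => ksq (site m k p) * x t (site m k p) ^ 2))
      - C / A * lsum l (fun k => lsum (box (S M)) (fun p => x t (site m k p) ^ 2)) <= dY.
Proof.
  intros Hkap. destruct (corrector_exists kappa Hkap) as [M HM]. exists M.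
  intros m gamma D Hm Hg HD. destruct (HM m gamma D Hm Hg HD) as (C & HC & H).
  exists C. split; auto. intros A HA l.
  induction l as [|k l IH]; intros Hl.
  - exists (fun _ => 0). split.
    + intros x. rewrite Rabs_R0. change (lsum (@nil mode) _) with 0. lra.
    + intros x t _. exists 0. split; [apply (is_derive_const 0 t)|].
      unfold lsum at 1 2 4. cbn. lra.
  - destruct (H A HA k (Hl k (or_introl eq_refl))) as (Y1 & B1 & D1).
    destruct IH as (Y2 & B2 & D2); [intros; apply Hl; right; assumption|].
    exists (fun x => Y1 x + Y2 x). split.
    + intros x. rewrite lsum_cons. specialize (B1 x). specialize (B2 x).
      eapply Rle_trans; [apply Rabs_triang|]. lra.
    + intros x t Hx. destruct (D1 x t Hx) as (d1 & ? & ?), (D2 x t Hx) as (d2 & ? & ?).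
      exists (d1 + d2). split.
      * apply (is_derive_plus (fun u => Y1 (x u)) (fun u => Y2 (x u))); auto.
      * rewrite !lsum_cons. lra.
Qed.

Definition lowmodes (m : nat) : list mode := filter (low m) (box m).

Lemma in_lowmodes m k : In k (lowmodes m) <-> low m k = true.
Proof.
  unfold lowmodes. rewrite filter_In, in_box, lowP. intuition lia.
Qed.

(** Low coordinates differ by at most [m/2], so [(k, p)] is recovered from its site and each mode is
    counted once. The constants are therefore not multiplied by the number of low modes, which grows
    with [m]. *)
Lemma lsum_lowmodes_site_le m M N g : (1 <= m)%nat -> (m * (M + 1) <= N)%nat ->
  (forall k, 0 <= g k) ->
  lsum (lowmodes m) (fun k => lsum (box M) (fun p => g (site m k p))) <= lsum (box N) g.
Proof.
  intros Hm HN Hg.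
  pose proof (lsum_prod (lowmodes m) (box M) (fun kp => g (site m (fst kp) (snd kp)))) as E.
  cbn [fst snd] in E. rewrite <- E. clear E.
  rewrite <- (lsum_map (fun kp => site m (fst kp) (snd kp)) _ g).
  apply lsum_incl; auto using NoDup_box.
  - apply FinFun.Injective_map_NoDup_in.
    2:{ apply NoDup_list_prod; [apply NoDup_filter|]; apply NoDup_box. }
    intros [[k1 k2] [p1 p2]] [[l1 l2] [q1 q2]].
    rewrite !in_prod_iff, !in_lowmodes, !lowP. unfold site. cbn [fst snd].
    intros ((_ & ? & ?) & _) ((_ & ? & ?) & _) E. inversion E.
    assert (p1 = q1) by nia. assert (p2 = q2) by nia. subst.
    assert (k1 = l1) by lia. assert (k2 = l2) by lia. subst. reflexivity.
  - intros K. rewrite in_map_iff. intros ([k p] & <- & H).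
    rewrite in_prod_iff, in_lowmodes, lowP, in_box in H. cbn [fst snd].
    apply in_box. unfold site; cbn [fst snd]. split; nia.
Qed.

(** * Energy flux through the boundary of a box *)

(** Only pairs with one end outside the box survive, and both their ends are far out. The constant
    is [36 N^2] pairs times a coupling [2 N] times [64 B / N^6]; of the resulting [N^(-3)] only
    [1/N] is kept. *)
Lemma energy_flux_le m N B x : (1 <= N)%nat -> (2 * m <= N)%nat -> 0 <= B ->
  (forall k, (1 + ksq k) ^ 3 * x k ^ 2 <= B) ->
  Rabs (lsum (box N) (fun k => x k * advection m x k)) <= 4608 * B / INR N.
Proof.
  intros HN HmN HB Hx.
  set (sh := fun k s : mode => (fst k - Z.of_nat m * fst s, snd k - Z.of_nat m * snd s)%Z : mode).
  set (F := fun ks : mode * mode => coupling (fst ks) (snd ks) * (x (fst ks) * x (sh (fst ks) (snd ks)))).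
  set (q := fun ks : mode * mode => (znorm (sh (fst ks) (snd ks)) <=? Z.of_nat N)%Z).
  set (L := list_prod (box N) signs).
  assert (NL : NoDup L).
  { apply NoDup_list_prod; [apply NoDup_box|].
    unfold signs. repeat (apply NoDup_cons; [cbn; intuition congruence|]). apply NoDup_nil. }
  replace (lsum (box N) (fun k => x k * advection m x k)) with (lsum L F).
  2:{ unfold L. rewrite lsum_prod. apply lsum_ext. intros k _. unfold advection.
      rewrite <- lsum_scal. apply lsum_ext. intros s _. unfold F, sh. cbn [fst snd]. ring. }
  rewrite (lsum_filter_split q).
  (* The involution [(k, s) -> (k - m s, -s)] preserves the pairs that stay in the box and reverses
     the sign of [F]. *)
  assert (Z0 : lsum (filter q L) F = 0).
  { set (psi := fun ks : mode * mode => (sh (fst ks) (snd ks), (- fst (snd ks), - snd (snd ks))%Z : mode)).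
    assert (SS : forall k s : mode, sh (sh k s) (- fst s, - snd s)%Z = k).
    { intros [k1 k2] [s1 s2]. unfold sh; cbn [fst snd]. f_equal; ring. }
    assert (PP : forall ks, psi (psi ks) = ks).
    { intros [[k1 k2] [s1 s2]]. unfold psi, sh; cbn [fst snd]. f_equal; f_equal; ring. }
    assert (SG : forall s : mode, In s signs -> In (- fst s, - snd s)%Z signs).
    { intros s Hs. apply in_signs in Hs. destruct Hs as [->|[->|[->| ->]]]; cbn; auto. }
    assert (IN : forall ks, In ks (filter q L) -> In (psi ks) (filter q L)).
    { intros [k s]. unfold L, psi, q. cbn [fst snd]. rewrite !filter_In, !in_prod_iff.
      cbn [fst snd]. rewrite SS, !in_box, !Z.leb_le. unfold znorm.
      intros ((Hk & Hs) & Hq). repeat split; auto; lia. }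
    assert (P : Permutation (map psi (filter q L)) (filter q L)).
    { apply NoDup_Permutation; auto using NoDup_filter.
      - apply FinFun.Injective_map_NoDup; auto using NoDup_filter.
        intros u v E. now rewrite <- (PP u), E, PP.
      - intros ks. rewrite in_map_iff. split.
        + intros (u & <- & Hu). auto.
        + intros Hks. exists (psi ks). auto. }
    pose proof (lsum_perm _ _ F P) as E. rewrite lsum_map in E.
    rewrite (lsum_ext _ _ (fun ks => -1 * F ks)) in E.
    - rewrite lsum_scal in E. lra.
    - intros [k s] Hks. apply filter_In in Hks. destruct Hks as [Hks _].
      unfold L in Hks. rewrite in_prod_iff in Hks. destruct Hks as [_ Hs].
      unfold F, psi. cbn [fst snd]. rewrite SS.
      replace (coupling (sh k s) (- fst s, - snd s)%Z) with (- coupling k s); [ring|].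
      unfold coupling, sh. cbn [fst snd]. rewrite <- opp_IZR. f_equal.
      apply in_signs in Hs. destruct Hs as [->|[->|[->| ->]]]; cbn [fst snd]; ring. }
  rewrite Z0, Rplus_0_l. eapply Rle_trans; [apply lsum_Rabs|].
  set (n := INR N).
  assert (Hn : 1 <= n) by (apply (le_INR 1); auto).
  assert (Hn6 : 0 < n ^ 6) by (apply pow_lt; lra).
  apply Rle_trans with (lsum (filter (fun ks => negb (q ks)) L) (fun _ => 2 * n * (64 * B / n ^ 6))).
  - apply lsum_le. intros [k s] Hks. apply filter_In in Hks. destruct Hks as [Hks Hq].
    unfold L in Hks. rewrite in_prod_iff, in_box in Hks. destruct Hks as [Hk Hs].
    apply in_signs in Hs.
    unfold q in Hq. cbn [fst snd] in Hq. rewrite negb_true_iff, Z.leb_gt in Hq. unfold znorm in Hq.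
    unfold F. cbn [fst snd].
    (* One end lies outside the box and the other within [m <= N/2] of it, so both have a coordinate
       at least [N/2]. *)
    assert (DEC : forall k', n ^ 2 <= IZR 2 ^ 2 * ksq k' -> x k' ^ 2 <= 64 * B / n ^ 6).
    { intros k' Hk'. specialize (Hx k'). pose proof (ksq_nonneg k').
      apply (Rmult_le_reg_l (n ^ 6)); auto.
      replace (n ^ 6 * (64 * B / n ^ 6)) with (64 * B) by (field; lra).
      apply Rle_trans with (64 * ((1 + ksq k') ^ 3 * x k' ^ 2)); [|lra].
      rewrite <- Rmult_assoc. apply Rmult_le_compat_r; [apply pow2_ge_0|].
      replace (n ^ 6) with ((n ^ 2) ^ 3) by ring.
      replace (64 * (1 + ksq k') ^ 3) with ((4 * (1 + ksq k')) ^ 3) by ring.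
      apply pow_incr. split; [apply pow2_ge_0|]. lra. }
    assert (X1 : x k ^ 2 <= 64 * B / n ^ 6).
    { apply DEC. destruct k as [k1 k2]. apply ksq_ge; [lia|].
      unfold sh in Hq. cbn [fst snd] in *.
      destruct Hs as [->|[->|[->| ->]]]; cbn [fst snd] in *; lia. }
    assert (X2 : x (sh k s) ^ 2 <= 64 * B / n ^ 6).
    { apply DEC. destruct (sh k s) as [k1 k2]. cbn [fst snd] in *. apply ksq_ge; lia. }
    rewrite !Rabs_mult. apply Rmult_le_compat; auto using Rabs_pos.
    + apply Rmult_le_pos; apply Rabs_pos.
    + unfold coupling. rewrite <- abs_IZR. unfold n. rewrite INR_IZR_INZ, <- mult_IZR.
      apply IZR_le. destruct Hs as [->|[->|[->| ->]]]; cbn [fst snd]; lia.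
    + rewrite <- (pow2_abs (x k)) in X1. rewrite <- (pow2_abs (x (sh k s))) in X2.
      pose proof (pow2_ge_0 (Rabs (x k) - Rabs (x (sh k s)))). nra.
  - rewrite lsum_const.
    assert (HL : INR (length (filter (fun ks => negb (q ks)) L)) <= 36 * n ^ 2).
    { eapply Rle_trans; [apply le_INR, filter_length_le|].
      unfold L. rewrite length_prod, length_box. cbn [length signs].
      rewrite !mult_INR, plus_INR, mult_INR. fold n. cbn [INR]. nra. }
    assert (P0 : 0 <= 2 * n * (64 * B / n ^ 6)).
    { apply Rmult_le_pos; [lra|]. apply Rdiv_le_0_compat; lra. }
    apply Rle_trans with (36 * n ^ 2 * (2 * n * (64 * B / n ^ 6))).
    { now apply Rmult_le_compat_r. }
    replace (36 * n ^ 2 * (2 * n * (64 * B / n ^ 6))) with (4608 * B / n * / n ^ 2) by (field; lra).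
    rewrite <- (Rmult_1_r (4608 * B / n)) at 2. apply Rmult_le_compat_l.
    + apply Rdiv_le_0_compat; lra.
    + rewrite <- Rinv_1. apply Rinv_le_contravar; nra.
Qed.

(** * Decay of the energy *)

Lemma gronwall_decay (z : R -> R) a b lam err : a <= b -> 0 < lam -> 0 <= err ->
  (forall t, a <= t <= b -> exists d, is_derive z t d /\ d <= - lam * z t + err) ->
  z b <= exp (- lam * (b - a)) * z a + err / lam.
Proof.
  intros Hab Hl He H.
  (* Integrating factor applied to the distance from the equilibrium [err / lam]; this [w] is
     nonincreasing. *)
  set (w := fun t => exp (lam * t) * (z t - err / lam)).
  assert (Dw : forall t, a <= t <= b ->
    exists d, is_derive w t d /\ d <= 0).
  { intros t Ht. destruct (H t Ht) as (d & Hd & Hle).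
    exists (lam * exp (lam * t) * (z t - err / lam) + exp (lam * t) * d). split.
    - apply (is_derive_mult (fun t => exp (lam * t)) (fun t => z t - err / lam)).
      + auto_derive; auto. ring.
      + replace d with (d - 0) by ring. apply (is_derive_minus z (fun _ => err / lam)); auto.
        apply (is_derive_const (err / lam) t).
      + exact Rmult_comm.
    - replace (lam * exp (lam * t) * (z t - err / lam) + exp (lam * t) * d)
        with (exp (lam * t) * (lam * z t - err + d)) by (field; lra).
      pose proof (exp_pos (lam * t)). nra. }
  assert (W : w b <= w a).
  { destruct Hab as [Hab| ->]; [|lra].
    destruct (MVT_gen w a b (Derive w)) as (c & Hc & E).
    - rewrite Rmin_left, Rmax_right by lra. intros t Ht.
      destruct (Dw t) as (d & Hd & _); [lra|]. apply Derive_correct. now exists d.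
    - rewrite Rmin_left, Rmax_right by lra. intros t Ht.
      destruct (Dw t Ht) as (d & Hd & _).
      apply derivable_continuous_pt. exists d. now apply is_derive_Reals.
    - rewrite Rmin_left, Rmax_right in Hc by lra.
      destruct (Dw c Hc) as (d & Hd & Hle). rewrite (is_derive_unique _ _ _ Hd) in E. nra. }
  unfold w in W. apply (Rmult_le_compat_l (exp (- (lam * b)))) in W; [|left; apply exp_pos].
  rewrite <- !Rmult_assoc, <- !exp_plus in W.
  replace (- (lam * b) + lam * b) with 0 in W by ring.
  replace (- (lam * b) + lam * a) with (- lam * (b - a)) in W by ring.
  rewrite exp_0 in W. pose proof (exp_pos (- lam * (b - a))).
  assert (0 <= err / lam) by (apply Rdiv_le_0_compat; lra). nra.
Qed.

Definition energy (N : nat) (x : mode -> R) : R := lsum (box N) (fun k => x k ^ 2).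

Lemma energy_nonneg N x : 0 <= energy N x.
Proof. apply lsum_nonneg. intros; apply pow2_ge_0. Qed.

Lemma energy_derive m A gamma D x t N : evolves m A gamma D x t ->
  is_derive (fun u => energy N (x u)) t
    (2 * PI ^ 2 * A * lsum (box N) (fun k => x t k * advection m (x t) k)
     - 2 * gamma * lsum (box N) (fun k => D k * x t k ^ 2)).
Proof.
  intros Hx. unfold Rminus. rewrite Ropp_mult_distr_l, <- !lsum_scal, <- lsum_plus.
  apply (is_derive_lsum (box N) (fun k u => x u k ^ 2)). intros k _.
  replace (2 * PI ^ 2 * A * (x t k * advection m (x t) k) + - (2 * gamma) * (D k * x t k ^ 2))
    with (INR 2 * (PI ^ 2 * A * advection m (x t) k - gamma * D k * x t k) * x t k ^ Nat.pred 2)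
    by (cbn; ring).
  apply (is_derive_pow (fun u => x u k) 2). apply Hx.
Qed.

(** A Poincare inequality mode by mode: the zero mode vanishes, low modes are paid by the last sum,
    and any other mode has [16 ksq k >= m^2]. *)
Lemma energy_le_gradient_low m N beta gamma x : (m <= N)%nat -> 0 < gamma -> 0 < beta ->
  4 * beta <= PI ^ 2 * gamma * INR m ^ 2 -> x (0, 0)%Z = 0 ->
  beta * energy N x <=
  4 * PI ^ 2 * gamma * lsum (box N) (fun k => ksq k * x k ^ 2)
  + beta * lsum (lowmodes m) (fun k => x k ^ 2).
Proof.
  intros HmN Hg Hb Hm Hx0.
  assert (HL : lsum (lowmodes m) (fun k => x k ^ 2) =
    lsum (box N) (fun k => if low m k then x k ^ 2 else 0)).
  { rewrite <- lsum_filter. apply lsum_perm, NoDup_Permutation;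
      [apply NoDup_filter, NoDup_box|apply NoDup_filter, NoDup_box|].
    intros k. rewrite in_lowmodes, filter_In, in_box, lowP. intuition lia. }
  rewrite HL. unfold energy. rewrite <- !lsum_scal, <- lsum_plus.
  apply lsum_le. intros k _. pose proof (pow2_ge_0 (x k)). pose proof (ksq_nonneg k).
  pose proof PI2_ge_1.
  assert (0 <= 4 * PI ^ 2 * gamma * (ksq k * x k ^ 2)).
  { apply Rmult_le_pos; [|nra]. apply Rmult_le_pos; lra. }
  destruct (low m k) eqn:Lk; [lra|].
  destruct (zero_mode k) eqn:Zk.
  { apply zero_modeP in Zk. subst. rewrite Hx0. lra. }
  assert (B : INR m ^ 2 <= 16 * ksq k).
  { replace 16 with (IZR 4 ^ 2) by (cbn; ring). destruct k as [k1 k2].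
    apply ksq_ge; [lia|]. unfold low in Lk. rewrite Zk in Lk. cbn [negb andb fst snd] in Lk.
    apply andb_false_iff in Lk. rewrite !Z.leb_gt in Lk. lia. }
  rewrite Rmult_0_r, Rplus_0_r.
  replace (4 * PI ^ 2 * gamma * (ksq k * x k ^ 2))
    with (PI ^ 2 * gamma * (16 * ksq k) / 4 * x k ^ 2) by field.
  apply Rmult_le_compat_r; auto.
  assert (PI ^ 2 * gamma * INR m ^ 2 <= PI ^ 2 * gamma * (16 * ksq k)).
  { apply Rmult_le_compat_l; [nra|auto]. }
  lra.
Qed.

(** The Lyapunov function [z] satisfies [energy <= 2 z <= 3 energy], whence the factor 3. [N0] is
    chosen last, after [A], [B] and [eta]. *)
Lemma energy_decay gamma beta : 0 < gamma -> 0 < beta ->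
  exists m0 : R, 0 < m0 /\ forall m : nat, m0 <= INR m ->
  forall D : mode -> R, (forall k, 4 * PI ^ 2 * ksq k <= D k) ->
  exists A0 : R, 0 < A0 /\ forall A, A0 <= A ->
  forall (x : R -> mode -> R) (a b B : R), a <= b ->
  (forall t, a <= t <= b -> evolves m A gamma D x t) ->
  (forall t, a <= t <= b -> x t (0, 0)%Z = 0) ->
  (forall t, a <= t <= b -> forall k, (1 + ksq k) ^ 3 * x t k ^ 2 <= B) ->
  forall eta, 0 < eta -> exists N0, forall N, (N0 <= N)%nat ->
  energy N (x b) <= 3 * exp (- (beta / 2) * (b - a)) * energy N (x a) + eta.
Proof.
  intros Hg Hb. pose proof PI2_ge_1 as Hpi.
  set (c := PI ^ 2 * gamma). assert (Hc : 0 < c) by (unfold c; nra).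
  (* Makes [beta * kappa = 2 c], a quarter of the dissipation [8 c G]; the term in [16 n / m^2] is
     allowed another quarter. *)
  set (kappa := 2 * c / beta).
  assert (Hkap : 0 < kappa) by (unfold kappa; apply Rdiv_lt_0_compat; lra).
  destruct (correctors_exist kappa Hkap) as [M HM].
  set (n := INR (length (box (S M)))).
  assert (Hn : 0 <= n) by apply pos_INR.
  assert (Hq1 : 0 <= 8 * n * beta / c) by (apply Rdiv_le_0_compat; nra).
  assert (Hq2 : 0 <= 4 * beta / c) by (apply Rdiv_le_0_compat; nra).
  (* The second term gives [Hn_m], the third [Hb_m], and the 1 ensures [m <= m^2]. *)
  exists (1 + 8 * n * beta / c + 4 * beta / c). split; [lra|].
  intros m Hm0 D HD.
  assert (Hm1 : 1 <= INR m) by lra.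
  assert (Hm : (1 <= m)%nat) by (apply INR_le; exact Hm1).
  assert (Hm2 : INR m <= INR m ^ 2) by nra.
  assert (Hn_m : beta * (16 * n / INR m ^ 2) <= 2 * c).
  { apply (Rmult_le_reg_r (INR m ^ 2)); [nra|].
    replace (beta * (16 * n / INR m ^ 2) * INR m ^ 2) with (2 * c * (8 * n * beta / c))
      by (field; split; lra).
    apply Rmult_le_compat_l; lra. }
  assert (Hb_m : 4 * beta <= PI ^ 2 * gamma * INR m ^ 2).
  { fold c. replace (4 * beta) with (c * (4 * beta / c)) by (field; lra).
    apply Rmult_le_compat_l; lra. }
  assert (HD0 : forall k, 0 <= D k).
  { intros k. eapply Rle_trans; [|apply HD]. pose proof (ksq_nonneg k). nra. }
  destruct (HM m gamma D Hm (Rlt_le _ _ Hg) HD0) as (C & HC & HY).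
  assert (HbC : 0 < beta * C) by (apply Rmult_lt_0_compat; lra).
  (* The first term gives [C / A <= 1/4], for the loss in the rate; the second gives
     [beta C / A <= 1/2], which keeps [z] comparable to the energy. *)
  exists (4 * C + 2 * (beta * C)). split; [lra|].
  intros A HA x a b B Hab Hev Hx0 HB eta Heta.
  assert (HA0 : 0 < A) by lra.
  assert (HCA : C / A <= / 4 /\ beta * (C / A) <= / 2).
  { assert (E : C / A * A = C) by (field; lra). assert (0 < C / A) by (apply Rdiv_lt_0_compat; lra).
    split; apply (Rmult_le_reg_r A); auto; rewrite ?Rmult_assoc, E; lra. }
  destruct HCA as [HCA1 HCA2].
  assert (HCA0 : 0 < C / A) by (apply Rdiv_lt_0_compat; lra).
  destruct (HY A HA0 (lowmodes m)) as (Y & HYb & HYd).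
  { intros k. apply in_lowmodes. }
  assert (HB0 : 0 <= B).
  { eapply Rle_trans; [|apply (HB a) with (k := (0, 0)%Z); lra].
    apply Rmult_le_pos; [|apply pow2_ge_0]. apply pow_le. pose proof (ksq_nonneg (0, 0)%Z). lra. }
  set (c0 := 2 * PI ^ 2 * A * (4608 * B)).
  assert (HPA : 0 <= 2 * PI ^ 2 * A) by (apply Rmult_le_pos; lra).
  assert (Hc0 : 0 <= c0) by (unfold c0; apply Rmult_le_pos; lra).
  destruct (INR_unbounded (4 * c0 / (beta * eta))) as [N1 HN1].
  exists (N1 + m * (S M + 1) + 2 * m + 1)%nat. intros N HN.
  assert (HNp : 0 < INR N) by (apply lt_0_INR; lia).
  set (err := c0 / INR N).
  assert (Herr0 : 0 <= err) by (apply Rdiv_le_0_compat; auto).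
  assert (Herr : 4 * err <= beta * eta).
  { unfold err. apply (Rmult_le_reg_r (INR N)); auto.
    replace (4 * (c0 / INR N) * INR N) with (beta * eta * (4 * c0 / (beta * eta))) by (field; nra).
    apply Rmult_le_compat_l; [nra|]. assert (INR N1 <= INR N) by (apply le_INR; lia). lra. }
  assert (HXN : forall y, lsum (lowmodes m) (fun k => lsum (box (S M)) (fun p => y (site m k p) ^ 2))
    <= energy N y).
  { intros y. apply (lsum_lowmodes_site_le m (S M) N (fun k => y k ^ 2)); auto; [lia|].
    intros; apply pow2_ge_0. }
  assert (HYN : forall y, Rabs (beta * Y y) <= energy N y / 2).
  { intros y. rewrite Rabs_mult, (Rabs_pos_eq beta) by lra.
    specialize (HYb y). specialize (HXN y). pose proof (energy_nonneg N y).
    apply Rle_trans with (beta * (C / A * energy N y)); [|nra].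
    apply Rmult_le_compat_l; [lra|]. eapply Rle_trans; [exact HYb|].
    apply Rmult_le_compat_l; lra. }
  set (z := fun t => energy N (x t) - beta * Y (x t)).
  assert (Hz : forall t, energy N (x t) <= 2 * z t /\ 2 * z t <= 3 * energy N (x t)).
  { intros t. specialize (HYN (x t)). apply Rabs_le_between in HYN. unfold z. lra. }
  assert (G : z b <= exp (- (beta / 2) * (b - a)) * z a + err / (beta / 2)).
  { apply gronwall_decay; auto; [lra|]. intros t Ht.
    destruct (HYd x t (Hev t Ht)) as (dY & HdY & HdYle).
    exists (2 * PI ^ 2 * A * lsum (box N) (fun k => x t k * advection m (x t) k)
      - 2 * gamma * lsum (box N) (fun k => D k * x t k ^ 2) - beta * dY).
    split.
    - apply (is_derive_minus (fun u => energy N (x u)) (fun u => beta * Y (x u))).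
      + apply energy_derive. auto.
      + apply (is_derive_scal (fun u => Y (x u))). exact HdY.
    - assert (F : Rabs (lsum (box N) (fun k => x t k * advection m (x t) k)) <= 4608 * B / INR N).
      { apply energy_flux_le; auto; lia. }
      apply Rabs_le_between in F. destruct F as [_ F].
      assert (F' : 2 * PI ^ 2 * A * lsum (box N) (fun k => x t k * advection m (x t) k) <= err).
      { replace err with (2 * PI ^ 2 * A * (4608 * B / INR N)) by (unfold err, c0; field; lra).
        apply Rmult_le_compat_l; [exact HPA|exact F]. }
      set (G := lsum (box N) (fun k => ksq k * x t k ^ 2)).
      assert (HG0 : 0 <= G).
      { apply lsum_nonneg. intros. apply Rmult_le_pos; [apply ksq_nonneg|apply pow2_ge_0]. }
      assert (HGD : 4 * PI ^ 2 * G <= lsum (box N) (fun k => D k * x t k ^ 2)).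
      { unfold G. rewrite <- lsum_scal. apply lsum_le. intros k _. rewrite <- Rmult_assoc.
        apply Rmult_le_compat_r; [apply pow2_ge_0|apply HD]. }
      assert (HGl : lsum (lowmodes m) (fun k => lsum (box (S M)) (fun p =>
          ksq (site m k p) * x t (site m k p) ^ 2)) <= G).
      { apply (lsum_lowmodes_site_le m (S M) N (fun k => ksq k * x t k ^ 2)); auto; [lia|].
        intros. apply Rmult_le_pos; [apply ksq_nonneg|apply pow2_ge_0]. }
      assert (HE : beta * energy N (x t) <= 4 * PI ^ 2 * gamma * G
          + beta * lsum (lowmodes m) (fun k => x t k ^ 2)).
      { apply energy_le_gradient_low; auto; lia. }
      specialize (HXN (x t)). destruct (Hz t) as [Hz1 Hz2].
      pose proof (energy_nonneg N (x t)) as HEn.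
      fold n in HdYle.
      assert (Hrho : 0 <= kappa + 16 * n / INR m ^ 2).
      { assert (0 <= 16 * n / INR m ^ 2) by (apply Rdiv_le_0_compat; nra). lra. }
      assert (Hbrho : beta * (kappa + 16 * n / INR m ^ 2) <= 4 * c).
      { rewrite Rmult_plus_distr_l.
        replace (beta * kappa) with (2 * c) by (unfold kappa; field; lra). lra. }
      set (l0 := lsum (lowmodes m) (fun k => x t k ^ 2)) in *.
      assert (T1 : beta * (l0 - (kappa + 16 * n / INR m ^ 2) * G - C / A * energy N (x t)) <= beta * dY).
      { apply Rmult_le_compat_l; [lra|]. eapply Rle_trans; [|exact HdYle].
        assert (C / A * lsum (lowmodes m) (fun k => lsum (box (S M)) (fun p => x t (site m k p) ^ 2))
          <= C / A * energy N (x t)) by (apply Rmult_le_compat_l; lra).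
        assert ((kappa + 16 * n / INR m ^ 2) * lsum (lowmodes m) (fun k => lsum (box (S M)) (fun p =>
          ksq (site m k p) * x t (site m k p) ^ 2)) <= (kappa + 16 * n / INR m ^ 2) * G)
          by (apply Rmult_le_compat_l; lra).
        lra. }
      assert (T2 : beta * (kappa + 16 * n / INR m ^ 2) * G <= 4 * c * G)
        by (apply Rmult_le_compat_r; lra).
      (* Half of the dissipation pays for [T2] and half enters [HE]. With the loss [T4], the
         derivative of [z] is at most [- (3/4) beta energy + err], and [T5] converts this into the
         rate [beta / 2]. *)
      assert (T3 : 8 * c * G <= 2 * gamma * lsum (box N) (fun k => D k * x t k ^ 2)).
      { unfold c. replace (8 * (PI ^ 2 * gamma) * G) with (2 * gamma * (4 * PI ^ 2 * G)) by ring.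
        apply Rmult_le_compat_l; lra. }
      assert (T4 : beta * (C / A * energy N (x t)) <= beta * (/ 4 * energy N (x t))).
      { apply Rmult_le_compat_l; [lra|]. apply Rmult_le_compat_r; lra. }
      replace (4 * PI ^ 2 * gamma * G) with (4 * c * G) in HE by (unfold c; ring).
      assert (T5 : beta * z t <= beta * (3 / 2 * energy N (x t)))
        by (apply Rmult_le_compat_l; lra).
      lra. }
  destruct (Hz b) as [Hzb _]. destruct (Hz a) as [_ Hza].
  assert (G1 : err / (beta / 2) <= eta / 2).
  { apply (Rmult_le_reg_r beta); auto.
    replace (err / (beta / 2) * beta) with (2 * err) by (field; lra). lra. }
  pose proof (exp_pos (- (beta / 2) * (b - a))) as Hexp.
  assert (exp (- (beta / 2) * (b - a)) * (2 * z a) <= exp (- (beta / 2) * (b - a)) * (3 * energy N (x a)))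
    by (apply Rmult_le_compat_l; lra).
  lra.
Qed.

(** * From the Fourier formulation to the real system *)

(* The coupling coefficients are real, so real and imaginary parts decouple. *)
Lemma advect_cellular A m f k :
  advect (cellular_hat A m) f k =
  (- (PI ^ 2 * A * advection m (fun j => fst (f j)) k),
   - (PI ^ 2 * A * advection m (fun j => snd (f j)) k)).
Proof.
  unfold advect, cellular_hat, advection, lsum, signs, coupling.
  cbn [map fold_right fst snd].
  unfold Cplus, Cmult, RtoC. cbn [fst snd].
  rewrite !minus_IZR, !mult_IZR.
  f_equal; field.
Qed.

(** The symbol of the Laplacian is at least 1 at nonzero modes, so a power [alpha >= 1] only raises
    it. This is where [1 <= alpha] enters. *)
Lemma frac_symbol_ge alpha k : 1 <= alpha -> 4 * PI ^ 2 * ksq k <= frac_symbol alpha k.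
Proof.
  intros Ha. unfold frac_symbol. fold (zero_mode k). destruct (zero_mode k) eqn:Z.
  - apply zero_modeP in Z. subst. unfold ksq. cbn. lra.
  - fold (ksq k). set (X := 4 * PI ^ 2 * ksq k).
    assert (H1 : 1 <= ksq k).
    { apply andb_false_iff in Z. rewrite !Z.eqb_neq in Z.
      assert (B : INR 1 ^ 2 <= IZR 1 ^ 2 * ksq k); [|cbn in B; lra].
      rewrite (surjective_pairing k). apply ksq_ge; lia. }
    pose proof PI2_ge_1.
    assert (1 <= X) by (unfold X; nra).
    rewrite <- (Rpower_1 X) at 1 by lra.
    destruct (Req_dec X 1) as [->|].
    + unfold Rpower. rewrite ln_1, !Rmult_0_r. lra.
    + apply Rle_Rpower; lra.
Qed.

Lemma Cmod_sqr z : Cmod z ^ 2 = fst z ^ 2 + snd z ^ 2.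
Proof. unfold Cmod. apply pow2_sqrt. nra. Qed.

Lemma boxsum_Cmod_sqr N f :
  boxsum N (fun k => Cmod (f k) ^ 2) =
  energy N (fun k => fst (f k)) + energy N (fun k => snd (f k)).
Proof.
  unfold energy. rewrite <- lsum_plus. apply lsum_ext. intros; apply Cmod_sqr.
Qed.

Lemma boxsum_le_tsum N g (c : R) : Rbar_le (tsum g) c -> boxsum N g <= c.
Proof.
  intros H. apply (Rbar_le_trans (boxsum N g) (tsum g) c); auto.
  unfold tsum. apply (proj1 (Lub_Rbar_correct _)). now exists N.
Qed.

Lemma tsum_le g (c : R) : (forall N, boxsum N g <= c) -> Rbar_le (tsum g) c.
Proof.
  intros H. unfold tsum. apply (proj2 (Lub_Rbar_correct _)).
  intros r (N & ->). apply H.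
Qed.

Lemma term_le_tsum g k (c : R) : (forall j, 0 <= g j) -> Rbar_le (tsum g) c -> g k <= c.
Proof.
  intros Hg H.
  apply Rle_trans with (boxsum (Z.to_nat (znorm k)) g); [|now apply boxsum_le_tsum].
  apply (lsum_term _ g); auto. apply in_box. unfold znorm. lia.
Qed.

Lemma energy_triangle N x y z : (forall k, z k = x k - y k) ->
  energy N x <= 2 * energy N y + 2 * energy N z.
Proof.
  intros H. unfold energy. rewrite <- !lsum_scal, <- lsum_plus. apply lsum_le.
  intros k _. rewrite H. pose proof (pow2_ge_0 (x k - 2 * y k)). nra.
Qed.

Lemma solution_evolves A m alpha gamma s th0 theta t :
  is_solution (cellular_hat A m) alpha gamma s th0 theta -> s < t ->
  evolves m A gamma (frac_symbol alpha) (fun u k => fst (theta u k)) t /\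
  evolves m A gamma (frac_symbol alpha) (fun u k => snd (theta u k)) t.
Proof.
  intros (_ & _ & _ & H) Ht. split; intros k; destruct (H t Ht k) as [H1 H2];
    apply is_derive_Reals; rewrite advect_cellular in H1, H2; unfold Cplus, Cmult, Copp, RtoC in *;
    cbn [fst snd] in *.
  - eapply eq_rect; [exact H1|]. ring.
  - eapply eq_rect; [exact H2|]. ring.
Qed.

Lemma evolves_mean m A gamma alpha x t : evolves m A gamma (frac_symbol alpha) x t ->
  is_derive (fun u => x u (0, 0)%Z) t 0.
Proof.
  intros H. specialize (H (0, 0)%Z).
  replace (PI ^ 2 * A * advection m (x t) (0, 0)%Z
    - gamma * frac_symbol alpha (0, 0)%Z * x t (0, 0)%Z) with 0 in H; auto.
  unfold frac_symbol, advection, lsum, signs, coupling.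
  cbn [map fold_right fst snd Z.eqb andb]. rewrite !Z.mul_0_r, Z.sub_0_r. ring.
Qed.

(** The equation is available only after time [s], where it makes the mean constant; the value of
    that constant comes from the continuity in [L^2] at [s]. *)
Lemma solution_mean_zero A m alpha gamma s th0 theta t :
  is_solution (cellular_hat A m) alpha gamma s th0 theta -> th0 (0, 0)%Z = RtoC 0 -> s < t ->
  fst (theta t (0, 0)%Z) = 0 /\ snd (theta t (0, 0)%Z) = 0.
Proof.
  intros Hsol H0 Ht.
  assert (C : forall u, s < u -> u < t -> theta u (0, 0)%Z = theta t (0, 0)%Z).
  { intros u Hu Hut.
    assert (E : fst (theta u (0, 0)%Z) = fst (theta t (0, 0)%Z) /\
                snd (theta u (0, 0)%Z) = snd (theta t (0, 0)%Z)).
    { split.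
      - apply (eq_is_derive (fun v => fst (theta v (0, 0)%Z)) u t); auto.
        intros v Hv. apply (evolves_mean m A gamma alpha (fun u k => fst (theta u k))).
        eapply solution_evolves; [exact Hsol|lra].
      - apply (eq_is_derive (fun v => snd (theta v (0, 0)%Z)) u t); auto.
        intros v Hv. apply (evolves_mean m A gamma alpha (fun u k => snd (theta u k))).
        eapply solution_evolves; [exact Hsol|lra]. }
    destruct (theta u (0, 0)%Z), (theta t (0, 0)%Z). cbn in E. destruct E; subst; auto. }
  set (q := fst (theta t (0, 0)%Z) ^ 2 + snd (theta t (0, 0)%Z) ^ 2).
  assert (Q : q <= 0).
  { apply le_epsilon. intros eps Heps. destruct Hsol as (_ & Hc & _).
    destruct (Hc eps Heps) as (delta & Hd & Hlim).
    set (u := s + Rmin delta (t - s) / 2).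
    pose proof (Rmin_l delta (t - s)). pose proof (Rmin_r delta (t - s)).
    assert (0 < Rmin delta (t - s)) by (apply Rmin_pos; lra).
    assert (Hu : s < u < s + delta) by (unfold u; lra).
    specialize (Hlim u Hu). unfold norm2 in Hlim.
    apply (term_le_tsum _ (0, 0)%Z) in Hlim; [|intros; apply pow2_ge_0].
    unfold Csub in Hlim. rewrite H0, Cmod_sqr, C in Hlim by (unfold u in *; lra).
    unfold Cminus, Cplus, Copp, RtoC in Hlim. cbn [fst snd] in Hlim.
    rewrite Ropp_0, !Rplus_0_r in Hlim. unfold q. lra. }
  unfold q in Q. split; nra.
Qed.

(** Since smoothness holds only after [s], the decay is run from a time [a > s]; continuity in [L^2]
    bounds the energy at [a] by twice that of the data, up to a small error. *)
Lemma half_contracting_cellular gamma alpha eps : 0 < gamma -> 1 <= alpha -> 0 < eps ->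
  exists m0 : R, 0 < m0 /\ forall m : nat, m0 <= INR m ->
  exists A0 : R, 0 < A0 /\ forall A : R, A0 <= A ->
  half_contracting (cellular_hat A m) alpha gamma eps.
Proof.
  (* Rate [beta / 2] over a time at least [eps / 2] gives an exponent at least 24, and
     [exp y >= 1 + y] then yields [3 e <= 1/8]. *)
  intros Hg Ha He. set (beta := 96 / eps).
  assert (Hb : 0 < beta) by (apply Rdiv_lt_0_compat; lra).
  destruct (energy_decay gamma beta Hg Hb) as (m0 & Hm0 & H). exists m0. split; auto.
  intros m Hm.
  destruct (H m Hm (frac_symbol alpha) (fun k => frac_symbol_ge alpha k Ha)) as (A0 & HA0 & H').
  exists A0. split; auto. intros A HA s Hs th0 theta (Hfin & Hmean & _) Hsol.
  specialize (H' A HA).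
  set (E0 := real (norm2 th0)). rewrite <- Hfin. fold E0. cbn [Rbar_mult Rbar_mult'].
  assert (HE0 : forall N, boxsum N (fun k => Cmod (th0 k) ^ 2) <= E0).
  { intros N. apply boxsum_le_tsum. fold (norm2 th0). rewrite <- Hfin. fold E0. apply Rle_refl. }
  apply tsum_le. intros N'. apply le_epsilon. intros d Hd.
  assert (Hsol' := Hsol). destruct Hsol as (_ & Hc & Hreg & _).
  destruct (Hc d Hd) as (delta & Hdelta & Hlim).
  (* Inside the window of continuity, and leaving at least half of the time [eps]. *)
  set (a := s + Rmin delta eps / 2). set (b := s + eps).
  pose proof (Rmin_l delta eps). pose proof (Rmin_r delta eps).
  assert (0 < Rmin delta eps) by (apply Rmin_pos; lra).
  assert (Hab : s < a /\ a < s + delta /\ eps / 2 <= b - a) by (unfold a, b; lra).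
  destruct Hab as (Hsa & Had & Hba).
  specialize (Hlim a (conj Hsa Had)).
  destruct (Hreg a b Hsa ltac:(lra) 3%nat) as [B HB].
  assert (HBk : forall t, a <= t <= b -> forall k,
    (1 + ksq k) ^ 3 * fst (theta t k) ^ 2 <= B /\ (1 + ksq k) ^ 3 * snd (theta t k) ^ 2 <= B).
  { intros t Ht k. specialize (HB t Ht). unfold hnorm2 in HB.
    apply (term_le_tsum _ k) in HB.
    - rewrite Cmod_sqr in HB. unfold ksq. rewrite <- Rplus_assoc.
      set (w := (1 + IZR (fst k) ^ 2 + IZR (snd k) ^ 2) ^ 3) in *.
      assert (0 <= w) by (apply pow_le; pose proof (pow2_ge_0 (IZR (fst k)));
                          pose proof (pow2_ge_0 (IZR (snd k))); lra).
      pose proof (pow2_ge_0 (fst (theta t k))). pose proof (pow2_ge_0 (snd (theta t k))). nra.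
    - intros j. apply Rmult_le_pos; [apply pow_le|apply pow2_ge_0].
      pose proof (pow2_ge_0 (IZR (fst j))). pose proof (pow2_ge_0 (IZR (snd j))). lra. }
  destruct (H' (fun u k => fst (theta u k)) a b B) with (eta := d / 4) as [N1 HN1]; try lra.
  { intros t Ht. eapply solution_evolves; [exact Hsol'|lra]. }
  { intros t Ht. eapply solution_mean_zero; [exact Hsol'|auto|lra]. }
  { intros t Ht k. now apply HBk. }
  destruct (H' (fun u k => snd (theta u k)) a b B) with (eta := d / 4) as [N2 HN2]; try lra.
  { intros t Ht. eapply solution_evolves; [exact Hsol'|lra]. }
  { intros t Ht. eapply solution_mean_zero; [exact Hsol'|auto|lra]. }
  { intros t Ht k. now apply HBk. }
  set (N := (N' + N1 + N2)%nat).
  specialize (HN1 N ltac:(lia)). specialize (HN2 N ltac:(lia)). cbv beta in HN1, HN2.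
  fold b. apply Rle_trans with (boxsum N (fun k => Cmod (theta b k) ^ 2)).
  { apply boxsum_le; [lia|]. intros; apply pow2_ge_0. }
  rewrite boxsum_Cmod_sqr.
  specialize (HE0 N). rewrite boxsum_Cmod_sqr in HE0.
  apply (boxsum_le_tsum N) in Hlim. rewrite boxsum_Cmod_sqr in Hlim.
  pose proof (energy_triangle N (fun k => fst (theta a k)) (fun k => fst (th0 k))
    (fun k => fst (Csub (theta a) th0 k)) (fun k => eq_refl)) as T1.
  pose proof (energy_triangle N (fun k => snd (theta a k)) (fun k => snd (th0 k))
    (fun k => snd (Csub (theta a) th0 k)) (fun k => eq_refl)) as T2.
  set (e := exp (- (beta / 2) * (b - a))) in *.
  (* Half of the target [1/4] for squared norms; the factor 2 of [energy_triangle] takes up the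
     rest. *)
  assert (He24 : 3 * e <= / 8).
  { assert (e * 24 <= 1); [|lra].
    assert (24 <= exp (beta / 2 * (b - a))).
    { eapply Rle_trans; [|apply exp_ineq1_le].
      assert (beta / 2 * (eps / 2) <= beta / 2 * (b - a)) by (apply Rmult_le_compat_l; lra).
      replace (beta / 2 * (eps / 2)) with 24 in * by (unfold beta; field; lra). lra. }
    replace 1 with (e * exp (beta / 2 * (b - a))).
    - apply Rmult_le_compat_l; auto. left; apply exp_pos.
    - unfold e. rewrite <- exp_plus, <- exp_0. f_equal. ring. }
  pose proof (energy_nonneg N (fun k => fst (theta a k))).
  pose proof (energy_nonneg N (fun k => snd (theta a k))).
  nra.
Qed.

Theorem theorem3p1 (gamma alpha : R) (hgamma : 0 < gamma) (halpha : 1 <= alpha) :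
  forall eps : R, 0 < eps ->
  exists m0 : R, 0 < m0 /\
    forall m : nat, m0 <= INR m ->
    exists A0 : R, 0 < A0 /\
      forall A : R, A0 <= A ->
        Rbar_le (tau_star (cellular_hat A m) alpha gamma) eps.
Proof.
  intros eps Heps.
  destruct (half_contracting_cellular gamma alpha eps hgamma halpha Heps) as (m0 & Hm0 & H).
  exists m0. split; auto. intros m Hm. destruct (H m Hm) as (A0 & HA0 & H').
  exists A0. split; auto. intros A HA. unfold tau_star.
  apply (proj1 (Glb_Rbar_correct _)). split; [lra|auto].
Qed.
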